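(* Let $n\ge 1$. For any $n$-dimensional polytope $P$ in Euclidean space $E^n$, the scissors automorphism group $\mathrm{Aut}(P)$ is quasi-perfect, that is, its commutator subgroup is perfect.
   Context: $E^n$ is $n$-dimensional Euclidean geometry and $I(E^n)$ is its group of isometries (compositions of translations, rotations, reflections). A simplex in $E^n$ is the convex hull of $n+1$ points in general position. A polytope $P\subset E^n$ is a subset that can be written as a finite union of simplices (bounded, not necessarily convex). A cover $\{P_i\subseteq P\}_{i\in I}$ is a finite set of polytopes $P_i\subseteq P$ whose union is $P$ and whose interiors are pairwise disjoint. A scissors congruence $P\to Q$ is an equivalence class of pairs consisting of a cover $\{P_i\subseteq P\}_{i\in I}$ and isometries $\{g_i\in I(E^n)\}_{i\in I}$ such that $\{g_iP_i\subseteq Q\}_{i\in I}$ is a cover; $(\{P_i\},\{g_i\})$ and $(\{P'_j\},\{g'_j\})$ are equivalent if there is a common refinement $\{P''_k\subseteq P\}_{k\in K}$ such that each $P''_k$ lies in some $P_i\cap P'_j$ with $g_i=g'_j$. Scissors congruences compose (as functions defined almost everywhere), and the scissors automorphism group $\mathrm{Aut}(P)$ is the group of scissors congruences from $P$ to itself. A group is perfect if it equals its own commutator subgroup. *)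

(* Defs.v *)
From HB Require Import structures.
From mathcomp Require Import all_boot all_order all_algebra.
From mathcomp Require Import generic_quotient.
From mathcomp Require Import all_classical all_reals all_analysis.
From mathcomp Require Import ring lra.

Set Implicit Arguments.
Unset Strict Implicit.
Unset Printing Implicit Defensive.

Import Order.TTheory GRing.Theory Num.Theory numFieldNormedType.Exports.

Local Open Scope classical_set_scope.
Local Open Scope ring_scope.

Section Regular.
Variable T : topologicalType.
Implicit Types A B : set T.

Lemma regclosed_closed A : regclosed A -> closed A.
Proof. by move=> <-; exact: closed_closure. Qed.

Lemma regclosed_meet A U : regclosed A -> open U -> A `&` U !=set0 ->
  A° `&` U !=set0.
Proof.
move=> rA oU [x [Ax Ux]].
have clx : closure A° x by rewrite rA.
by have := clx _ (open_nbhs_nbhs (conj oU Ux)).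
Qed.

Lemma finite_bigcup_closed (I : finType) (F : I -> set T) :
  (forall i, closed (F i)) -> closed (\bigcup_i F i).
Proof. by move=> cF; apply: closed_bigcup => //; exact: finite_finset. Qed.

(* A `&` B with its lower-dimensional parts removed *)
Definition regI A B : set T := closure (A `&` B)°.

Lemma regI_reg A B : regclosed (regI A B).
Proof. exact/closure_open_regclosed/open_interior. Qed.

Lemma regI_subl A B : closed A -> regI A B `<=` A.
Proof.
move=> /closure_id cA; rewrite {2}cA; apply: closureS.
by move=> x /interior_subset[].
Qed.

Lemma regI_subr A B : closed B -> regI A B `<=` B.
Proof.
move=> /closure_id cA; rewrite {2}cA; apply: closureS.
by move=> x /interior_subset[].
Qed.

Lemma regI_interior A B : closed A -> closed B ->
  (regI A B)° `<=` A° `&` B°.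
Proof.
by move=> cA cB x xAB; split; apply: interiorS xAB;
  [exact: regI_subl|exact: regI_subr].
Qed.

Lemma regI_cover (I : finType) A (G : I -> set T) :
  regclosed A -> (forall i, regclosed (G i)) -> A `<=` \bigcup_i G i ->
  \bigcup_i regI A (G i) = A.
Proof.
move=> rA rG AG; apply/seteqP; split=> [x [i _]|].
  by apply: regI_subl; exact: regclosed_closed.
have cU : closed (\bigcup_i regI A (G i)).
  by apply: finite_bigcup_closed => i; exact: closed_closure.
rewrite -{1}rA ((closure_id _).1 cU) => x xA.
apply: (closed_closure (A := \bigcup_i regI A (G i))) => B /= xB.
have [y [yA]] := xA _ (nbhs_interior xB).
rewrite -/(B°) => yB.
have [i _ Gi] := AG _ (interior_subset yA).
have [||z [zG [zA zB]]] := @regclosed_meet (G i) (A° `&` B°) (rG i).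
- by apply: openI; exact: open_interior.
- by exists y.
exists z; split; last exact: interior_subset zB.
apply: subset_closure; exists i => //; apply: subset_closure.
by rewrite interiorI.
Qed.

Lemma interior0U A B : closed A -> A° = set0 -> B° = set0 -> (A `|` B)° = set0.
Proof.
move=> cA A0 B0; apply/seteqP; split=> // x xAB.
have oU : open ((A `|` B)° `&` ~` A).
  by apply: openI; [exact: open_interior|rewrite openC].
have UB : (A `|` B)° `&` ~` A `<=` B°.
  rewrite -(open_subsetE _ oU).
  by move=> y [/interior_subset[Ay|By] nA]; [case: (nA Ay)|].
have UA : (A `|` B)° `<=` A.
  by move=> y yAB; apply: contrapT => nA; have := UB y (conj yAB nA); rewrite B0.
have : A° x by move: UA; rewrite (open_subsetE _ (open_interior _)); apply.
by rewrite A0.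
Qed.

Lemma closure_interior_mod A N : regclosed A -> closed N -> N° = set0 ->
  closure (A `|` N)° = A.
Proof.
move=> rA cN N0; apply/seteqP; split.
  rewrite [X in _ `<=` X]((closure_id _).1 (regclosed_closed rA)) => x xAN.
  apply: (closed_closure (A := A)) => B xB.
  have [y [yAN yB]] := xAN _ (nbhs_interior xB).
  have : ~ ((A `|` N)° `&` B° `<=` N).
    rewrite (open_subsetE _ (openI (@open_interior _ _) (@open_interior _ _))).
    by rewrite N0 => /(_ y (conj yAN yB)).
  move=> /existsNP[z /not_implyP[[/interior_subset[Az|//] zB] _]].
  exists z; split; [exact: subset_closure|exact: interior_subset].
by rewrite -{1}rA; apply/closureS/interiorS => x; left.
Qed.

Lemma homeo_interior (f g : T -> T) A : cancel f g -> cancel g f ->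
  continuous f -> continuous g -> (f @` A)° = f @` A°.
Proof.
move=> fK gK cf cg.
have im B : f @` B = g @^-1` B.
  apply/seteqP; split=> [_ [x Bx <-]|x Bx] /=; first by rewrite fK.
  by exists (g x).
have im' B : f @^-1` (f @` B) = B.
  by rewrite im; apply/seteqP; split=> x /=; rewrite fK.
apply/seteqP; split.
  rewrite im => x; rewrite im /= => xA.
  have : open (f @^-1` (f @` A)°).
    by move/continuousP: cf; apply; exact: open_interior.
  move=> oA.
  have : f @^-1` (f @` A)° `<=` A°.
    rewrite -(open_subsetE _ oA) -{2}(im' A).
    by move=> y /=; exact: interior_subset.
  by apply; rewrite /= gK im.
rewrite -(open_subsetE _).
  by move=> _ [x /interior_subset Ax <-]; exists x.
by rewrite im; move/continuousP: cg; apply; exact: open_interior.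
Qed.

Lemma homeo_closure (f g : T -> T) A : cancel f g -> cancel g f ->
  continuous f -> continuous g -> closure (f @` A) = f @` closure A.
Proof.
move=> fK gK cf cg.
have imC B : f @` (~` B) = ~` (f @` B).
  apply/seteqP; split=> [_ [x Bx <-] [y By /(can_inj fK) xy]|x Bx].
    by apply: Bx; rewrite -xy.
  by exists (g x); [move=> Bg; apply: Bx; exists (g x)|].
apply: setC_inj; rewrite -interiorC -imC -imC -interiorC.
exact: homeo_interior gK cf cg.
Qed.

End Regular.

Section Euclidean.
Variables (R : realType) (n : nat).
Local Notation E := 'rV[R]_n.
Implicit Types (x y : E) (v w : 'I_n.+1 -> E) (A B S : set E).

(* The norm of the library on 'rV[R]_n is the sup norm; it induces the same
   topology (used below for interiors) but not the same isometries. *)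
Definition edist x y : R := Num.sqrt (\sum_(i < n) (x 0 i - y 0 i) ^+ 2).

Definition affinely_independent v : Prop :=
  forall c : 'I_n.+1 -> R, \sum_i c i = 0 -> \sum_i c i *: v i = 0 ->
  forall i, c i = 0.

Definition conv_hull v : set E :=
  [set \sum_i t i *: v i |
    t in [set t : 'I_n.+1 -> R | (forall i, 0 <= t i) /\ \sum_i t i = 1]].

Definition simplex S : Prop :=
  exists2 v, affinely_independent v & S = conv_hull v.

(* The empty union is allowed, so that set0 is a polytope. *)
Definition is_polytope A : Prop :=
  exists (I : finType) (S : I -> set E),
    (forall i, simplex (S i)) /\ A = \bigcup_i S i.

(* finite unions of members of K, as an inductive predicate *)
Inductive union_of (K : set E -> Prop) : set E -> Prop :=
| union_of0 : union_of K set0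
| union_ofU A B : K A -> union_of K B -> union_of K (A `|` B).

Lemma union_of1 K A : K A -> union_of K A.
Proof.
by move=> KA; rewrite -[A]setU0; apply: union_ofU => //; exact: union_of0.
Qed.

Lemma union_of_setU K A B : union_of K A -> union_of K B -> union_of K (A `|` B).
Proof.
move=> KA KB; elim: KA => [|{}A C KA _ IH]; first by rewrite set0U.
by rewrite -setUA; exact: union_ofU.
Qed.

Lemma union_of_bind (K K' : set E -> Prop) A :
  (forall S, K S -> union_of K' S) -> union_of K A -> union_of K' A.
Proof.
move=> KK'; elim=> [|B C KB _ IH]; first exact: union_of0.
by apply: union_of_setU => //; exact: KK'.
Qed.

Lemma union_of_fin K (I : finType) (F : I -> set E) :
  (forall i, union_of K (F i)) -> union_of K (\bigcup_i F i).
Proof.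
move=> KF; suff H (s : seq I) : union_of K (\bigcup_(i in [set` s]) F i).
  rewrite (_ : [set: I] = [set` enum I]) //.
  by apply/seteqP; split=> i _ //=; rewrite mem_enum.
rewrite bigcup_seq; elim/big_ind : _ => //; first exact: union_of0.
exact: union_of_setU.
Qed.

Lemma polytope_union_of A : is_polytope A <-> union_of simplex A.
Proof.
split=> [[I [S [sS ->]]]|].
  by apply: union_of_fin => i; apply: union_of1.
elim=> [|S B sS _ [I [F [sF ->]]]].
  exists void, (fun=> set0); split; first by case.
  by apply/seteqP; split=> // x [[]].
exists (option I), (fun o => if o is Some i then F i else S); split.
  by case.
apply/seteqP; split=> x; last by move=> [[i|] _]; [right; exists i|left].
by move=> [Sx|[i _ Fx]]; [exists None|exists (Some i)].
Qed.

Definition aff (a : 'cV[R]_n) (c : R) x : R := (x *m a) 0 0 + c.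

Lemma aff_sum (I : finType) a c (t : I -> R) (v : I -> E) : \sum_i t i = 1 ->
  aff a c (\sum_i t i *: v i) = \sum_i t i * aff a c (v i).
Proof.
move=> t1; rewrite /aff mulmx_suml summxE.
under [RHS]eq_bigr do rewrite mulrDr.
rewrite big_split /= -mulr_suml t1 mul1r; congr (_ + _).
by apply: eq_bigr => i _; rewrite -scalemxAl mxE.
Qed.

Lemma aff2 a c (e : R) x y :
  aff a c ((1 - e) *: x + e *: y) = (1 - e) * aff a c x + e * aff a c y.
Proof. by rewrite /aff mulmxDl -!scalemxAl !mxE; ring. Qed.

Lemma aff_continuous a c : continuous (aff a c).
Proof.
move=> x; apply: (@cvgD _ _ _ (nbhs x)); last exact: cvg_cst.
rewrite (_ : (fun _ => _) = fun x : E => \sum_j x 0 j * a j 0); last first.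
  by apply/funext => y; rewrite mxE.
rewrite mxE; apply: (@cvg_big _ _ _ _ _ _ _ (nbhs x)) => [|j _].
  exact: add_continuous.
apply: (@cvgM _ _ (nbhs x)); last exact: cvg_cst.
exact: coord_continuous.
Qed.

Lemma closed_aff_ge0 a c : closed [set x | 0 <= aff a c x].
Proof.
have := @closed_comp _ _ (aff a c) [set r | 0 <= r] _ (@closed_ge R 0).
by apply=> x _; exact: aff_continuous.
Qed.

Lemma segment_nbhs x y A : nbhs x A ->
  exists2 e : R, 0 < e < 1 & A ((1 - e) *: x + e *: y).
Proof.
move=> xA.
have : (fun e : R => (1 - e) *: x + e *: y) @ (0 : R) --> (1 - 0) *: x + 0 *: y.
  apply: cvgD; apply: cvgZ; try exact: cvg_cst; last exact: cvg_id.
  by apply: cvgB; [exact: cvg_cst|exact: cvg_id].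
rewrite subr0 scale1r scale0r addr0 => /(_ A xA) /nbhs_ballP[d /= d0 dA].
exists (Num.min (d / 2) (1 / 2)).
  by rewrite lt_min gt_min; apply/andP; split; [apply/andP; split; lra|apply/orP; right; lra].
apply: dA; rewrite /ball /= sub0r normrN gtr0_norm ?lt_min; last by apply/andP; split; lra.
by rewrite gt_min; apply/orP; left; lra.
Qed.

Lemma barycentric v : affinely_independent v ->
  exists (a : 'I_n.+1 -> 'cV[R]_n) (c : 'I_n.+1 -> R),
    (forall x, \sum_i aff (a i) (c i) x *: v i = x /\ \sum_i aff (a i) (c i) x = 1)
    /\ (forall t, \sum_i t i = 1 -> forall i,
         aff (a i) (c i) (\sum_j t j *: v j) = t i).
Proof.
move=> av.
pose M : 'M[R]_(1 + n) := row_mx (const_mx 1) (\matrix_i v i).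
have MM (c : 'rV[R]_(1 + n)) :
    c *m M = row_mx (\sum_i c 0 i)%:M (\sum_i c 0 i *: v i).
  rewrite mul_mx_row; congr row_mx.
    apply/matrixP => i j; rewrite !ord1 !mxE eqxx mulr1n.
    by apply: eq_bigr => k _; rewrite mxE mulr1.
  by rewrite mulmx_sum_row; apply: eq_bigr => k _; rewrite rowK.
have uM : M \in unitmx.
  rewrite -row_free_unit; apply: inj_row_free => c; rewrite MM.
  move=> /(congr1 (fun u => (lsubmx u, rsubmx u))); rewrite !row_mxKl !row_mxKr.
  rewrite linear0 [rsubmx 0]linear0 => -[/matrixP /(_ 0 0)].
  rewrite !mxE eqxx mulr1n => c0 cv0.
  by apply/rowP => i; rewrite mxE; exact: av.
pose N := invmx M.
exists (fun i => col i (dsubmx N)), (fun i => usubmx N 0 i).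
have lE i x : aff (col i (dsubmx N)) (usubmx N 0 i) x = (row_mx 1%:M x *m N) 0 i.
  rewrite -[in RHS](vsubmxK N) mul_row_col mul1mx /aff addrC !mxE; congr (_ + _).
  by apply: eq_bigr => j _; rewrite !mxE.
split=> [x|t t1 i].
  have := mulmxKV uM (row_mx 1%:M x); rewrite MM => /eq_row_mx[/matrixP /(_ 0 0)].
  rewrite !mxE eqxx !mulr1n => s1 sx; split.
    by rewrite -[RHS]sx; apply: eq_bigr => i _; rewrite lE.
  by rewrite -[RHS]s1; apply: eq_bigr => i _; rewrite lE.
have tM : row_mx 1%:M (\sum_j t j *: v j) = (\row_j t j) *m M.
  rewrite MM; congr row_mx.
    by congr _%:M; rewrite -t1; apply: eq_bigr => j _; rewrite mxE.
  by apply: eq_bigr => j _; rewrite mxE.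
by rewrite lE tM mulmxK // mxE.
Qed.

Lemma conv_hullE v a c :
  (forall x, \sum_i aff (a i) (c i) x *: v i = x /\ \sum_i aff (a i) (c i) x = 1)
    /\ (forall t, \sum_i t i = 1 -> forall i,
         aff (a i) (c i) (\sum_j t j *: v j) = t i) ->
  conv_hull v = [set x | forall i, 0 <= aff (a i) (c i) x].
Proof.
move=> [H1 H2]; apply/seteqP; split=> [_ [t [t0 t1] <-] i|x x0] /=.
  by rewrite H2.
exists (fun i => aff (a i) (c i) x); last by have [] := H1 x.
by split => //; have [] := H1 x.
Qed.

Lemma aff_vertex v a c : (forall t, \sum_i t i = 1 -> forall i,
  aff (a i) (c i) (\sum_j t j *: v j) = t i) ->
  forall i : 'I_n.+1, aff (a i) (c i) (v i) = 1.
Proof.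
move=> H i; have := H (fun j => (j == i)%:R).
have -> : \sum_j (j == i)%:R = 1 :> R.
  rewrite (bigD1 i) //= eqxx big1 ?addr0 // => j /negPf ->; by [].
have -> : \sum_j (j == i)%:R *: v j = v i.
  by rewrite (bigD1 i) //= eqxx scale1r big1 ?addr0 // => j /negPf ->; rewrite scale0r.
by move=> /(_ erefl i) ->; rewrite eqxx.
Qed.

End Euclidean.

Section Polytopes.
Variables (R : realType) (n : nat).
Local Notation E := 'rV[R]_n.
Implicit Types (x y : E) (v w : 'I_n.+1 -> E) (A B S : set E).

Lemma simplex_closed S : simplex S -> closed S.
Proof.
move=> [v av ->]; have [a [c H]] := barycentric av; rewrite (conv_hullE H).
rewrite (_ : [set _ | _] = \bigcap_i [set x | 0 <= aff (a i) (c i) x]).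
  by apply: closed_bigI => i _; exact: closed_aff_ge0.
by apply/seteqP; split=> x x0 i => [_|]; [exact: x0|exact: (x0 i I)].
Qed.

Lemma simplex_regclosed S : simplex S -> regclosed S.
Proof.
move=> sS; have cS := simplex_closed sS; apply/seteqP; split.
  rewrite [X in _ `<=` X]((closure_id _).1 cS); apply: closureS.
  exact: interior_subset.
case: sS cS => [v av ->] _; have [a [c H]] := barycentric av.
rewrite (conv_hullE H) => x /= x0 B xB.
pose b := \sum_i (n.+1%:R^-1 : R) *: v i.
have ab i : 0 < aff (a i) (c i) b.
  rewrite H.2 ?invr_gt0 ?ltr0n //.
  by rewrite sumr_const card_ord -[_ *+ _]mulr_natl mulfV // pnatr_eq0.
have [e /andP[e0 e1] Be] := segment_nbhs b xB.
exists ((1 - e) *: x + e *: b); split=> //.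
suff : \forall y \near (1 - e) *: x + e *: b, forall i, 0 <= aff (a i) (c i) y by [].
apply: (@filter_forall E 'I_n.+1 (fun i y => 0 <= aff (a i) (c i) y) (nbhs _)) => i.
have : aff (a i) (c i) y @[y --> (1 - e) *: x + e *: b] -->
    aff (a i) (c i) ((1 - e) *: x + e *: b) by exact: aff_continuous.
move=> /(_ [set r | 0 <= r]); apply.
have /lt_nbhsr : 0 < aff (a i) (c i) ((1 - e) *: x + e *: b).
  by rewrite aff2; have := ab i; have := x0 i; nra.
by apply: filterS => r /ltW.
Qed.

Lemma aff_eq0_interior v a c :
  (forall t, \sum_i t i = 1 -> forall i,
    aff (a i) (c i) (\sum_j t j *: v j) = t i) ->
  forall i : 'I_n.+1, [set x | aff (a i) (c i) x = 0]° = set0.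
Proof.
move=> H i; apply/seteqP; split=> // x x0.
have [e /andP[e0 e1] /=] := segment_nbhs (v i) x0.
rewrite aff2 (aff_vertex H) (interior_subset x0 : aff _ _ x = 0); lra.
Qed.

(* replacing the vertex p by a point in the interior of the edge [p, q] *)
Definition cut_vertex v (p q : 'I_n.+1) (s : R) : 'I_n.+1 -> E :=
  fun i => if i == p then (1 - s) *: v p + s *: v q else v i.

Lemma cut_vertex_sum v p q s (c : 'I_n.+1 -> R) : p != q ->
  \sum_i c i *: cut_vertex v p q s i =
  \sum_i (if i == p then (1 - s) * c p else
          if i == q then c q + s * c p else c i) *: v i.
Proof.
move=> pq; rewrite (bigD1 p) //= (bigD1 q) 1?eq_sym //=.
rewrite [RHS](bigD1 p) //= [in RHS](bigD1 q) 1?eq_sym //=.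
rewrite /cut_vertex !eqxx ?(eq_sym q) (negPf pq) !addrA; congr (_ + _).
  rewrite scalerDr !scalerA !scalerDl (mulrC (c p)) -!addrA; congr (_ + _).
  by rewrite addrC (mulrC (c p)).
by apply: eq_bigr => i /andP[/negPf -> /negPf ->].
Qed.

Lemma cut_coord_sum p q s (c : 'I_n.+1 -> R) : p != q ->
  \sum_i (if i == p then (1 - s) * c p else
          if i == q then c q + s * c p else c i) = \sum_i c i.
Proof.
move=> pq; rewrite (bigD1 p) //= (bigD1 q) 1?eq_sym //=.
rewrite [RHS](bigD1 p) //= [in RHS](bigD1 q) 1?eq_sym //=.
rewrite !eqxx ?(eq_sym q) (negPf pq) !addrA; congr (_ + _); first by ring.
by apply: eq_bigr => i /andP[/negPf -> /negPf ->].
Qed.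

Lemma cut_vertex_indep v p q s : p != q -> s < 1 ->
  affinely_independent v -> affinely_independent (cut_vertex v p q s).
Proof.
move=> pq s1 av c c0; rewrite cut_vertex_sum // => cv0.
have H := av _ _ cv0; rewrite cut_coord_sum // in H.
have {}H := H c0.
have cp : c p = 0.
  by have /eqP := H p; rewrite eqxx mulf_eq0 => /orP[/eqP|/eqP //]; lra.
move=> i; have [->//|ip] := eqVneq i p; have := H i.
by rewrite (negPf ip); case: eqP => [->|//]; rewrite cp mulr0 addr0.
Qed.

Lemma cut_vertex_sub v p q s : p != q -> 0 <= s <= 1 ->
  conv_hull (cut_vertex v p q s) `<=` conv_hull v.
Proof.
move=> pq /andP[s0 s1] _ [t [t0 t1] <-]; rewrite cut_vertex_sum //.
eexists; last by reflexivity.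
split; last by rewrite cut_coord_sum.
move=> i; have tp := t0 p; case: eqP => _; first by rewrite mulr_ge0 // subr_ge0.
by case: eqP => _ //; rewrite addr_ge0 // mulr_ge0.
Qed.

Lemma cut_vertex_mem v p q s (t : 'I_n.+1 -> R) : p != q -> s < 1 ->
  (forall i, 0 <= t i) -> \sum_i t i = 1 -> s * t p <= (1 - s) * t q ->
  conv_hull (cut_vertex v p q s) (\sum_i t i *: v i).
Proof.
move=> pq s1 t0 t1 st; have s1' : 0 < 1 - s by rewrite subr_gt0.
pose u i := if i == p then t p / (1 - s) else
            if i == q then t q - s * (t p / (1 - s)) else t i.
have uE i : (if i == p then (1 - s) * u p else
             if i == q then u q + s * u p else u i) = t i.
  rewrite /u eqxx eqxx ?(eq_sym q) (negPf pq).
  case: eqP => [->|ip]; first by rewrite mulrC divfK // gt_eqF.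
  by case: eqP => [->|iq //]; rewrite subrK.
exists u; last first.
  by rewrite cut_vertex_sum //; apply: eq_bigr => i _; rewrite uE.
split; last by rewrite -(cut_coord_sum s u pq) -[RHS]t1; apply: eq_bigr => i _; rewrite uE.
move=> i; rewrite /u; case: eqP => _; first by rewrite divr_ge0 // ltW.
case: eqP => _ //; rewrite subr_ge0 mulrA ler_pdivrMr //; lra.
Qed.

Definition one_sided (l : E -> R) S :=
  (forall x, S x -> 0 <= l x) \/ (forall x, S x -> l x <= 0).

Lemma simplex_cut a c S : simplex S ->
  union_of (fun S' => [/\ simplex S', S' `<=` S & one_sided (aff a c) S']) S.
Proof.
move=> [v av ->].
set l := aff a c.
have [m] := ubnP #|[pred i | l (v i) != 0]|.
elim: m v av => [//|m IH] v av vm.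
have side (e : R) : (forall i, 0 <= e * l (v i)) ->
    forall x, conv_hull v x -> 0 <= e * l x.
  move=> lv _ [t [t0 t1] <-]; rewrite /l aff_sum // mulr_sumr.
  by apply: sumr_ge0 => i _; rewrite mulrCA mulr_ge0.
have [/existsP[p lp]|nlp] := boolP [exists p, 0 < l (v p)]; last first.
  apply: union_of1; split=> //; [by exists v|right=> x vx].
  have := side (-1) _ x vx; rewrite mulN1r oppr_ge0; apply=> i.
  by rewrite mulN1r oppr_ge0 leNgt; apply/negP => li; case/existsP: nlp; exists i.
have [/existsP[q lq]|nlq] := boolP [exists q, l (v q) < 0]; last first.
  apply: union_of1; split=> //; [by exists v|left=> x vx].
  have := side 1 _ x vx; rewrite mul1r; apply=> i.
  by rewrite mul1r leNgt; apply/negP => li; case/existsP: nlq; exists i.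
have pq : p != q by apply: contraTneq lp => ->; rewrite -leNgt ltW.
pose s := l (v p) / (l (v p) - l (v q)).
have d0 : 0 < l (v p) - l (v q) by lra.
have s0 : 0 < s by rewrite divr_gt0.
have s1 : s < 1 by rewrite ltr_pdivrMr // mul1r; lra.
have ls : (1 - s) * l (v p) + s * l (v q) = 0 by rewrite /s; field; lra.
have step (r : 'I_n.+1) w : affinely_independent w -> w r = (1 - s) *: v p + s *: v q ->
    (forall i, i != r -> w i = v i) -> l (v r) != 0 -> conv_hull w `<=` conv_hull v ->
    union_of (fun S' => [/\ simplex S', S' `<=` conv_hull v & one_sided l S'])
      (conv_hull w).
  move=> aw wr wi lr wv.
  apply: (@union_of_bind _ _
    (fun S' => [/\ simplex S', S' `<=` conv_hull w & one_sided l S'])).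
    by move=> S' [sS' S'w oS']; apply: union_of1; split=> //; exact: subset_trans wv.
  apply: IH => //; rewrite ltnS in vm; apply: leq_trans vm.
  apply: proper_card; apply/properP; split.
    apply/fintype.subsetP => i; rewrite !inE; have [->|ir] := eqVneq i r.
      by rewrite wr /l aff2 ls eqxx.
    by rewrite wi.
  by exists r; rewrite !inE // wr /l aff2 ls eqxx.
rewrite [X in union_of _ X](_ : conv_hull v = conv_hull (cut_vertex v p q s) `|`
                           conv_hull (cut_vertex v q p (1 - s))).
  apply: union_of_setU.
    apply: (step p).
    - exact: cut_vertex_indep.
    - by rewrite /cut_vertex eqxx.
    - by move=> i ip; rewrite /cut_vertex (negPf ip).
    - by rewrite gt_eqF.
    - by apply: cut_vertex_sub => //; apply/andP; split; exact: ltW.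
  apply: (step q).
  - by apply: cut_vertex_indep; rewrite 1?eq_sym //; lra.
  - by rewrite /cut_vertex eqxx addrC; congr (_ *: _ + _ *: _); ring.
  - by move=> i ip; rewrite /cut_vertex (negPf ip).
  - by rewrite lt_eqF.
  - by apply: cut_vertex_sub; rewrite 1?eq_sym //; apply/andP; split; lra.
apply/seteqP; split; last first.
  move=> x [|]; apply: cut_vertex_sub; rewrite // 1?eq_sym //; apply/andP; split; lra.
move=> _ [t [t0 t1] <-].
have [st|st] := leP (s * t p) ((1 - s) * t q); [left|right].
  exact: cut_vertex_mem.
by apply: cut_vertex_mem; rewrite 1?eq_sym //; lra.
Qed.

(* a polytope up to a closed set without interior *)
Definition polytope_mod A := exists U N,
  [/\ union_of (@simplex R n) U, closed N, N° = set0 & A = U `|` N].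

Lemma polytope_modU A B : polytope_mod A -> polytope_mod B ->
  polytope_mod (A `|` B).
Proof.
move=> [U [N [pU cN N0 ->]]] [V [M [pV cM M0 ->]]].
exists (U `|` V), (N `|` M); split; first exact: union_of_setU.
- exact: closedU.
- exact: interior0U.
- by rewrite setUACA.
Qed.

Lemma polytope_mod0 : polytope_mod set0.
Proof.
exists set0, set0; split; [exact: union_of0|exact: closed0|exact: interior0|].
by rewrite setU0.
Qed.

Lemma simplexI_mod S T : simplex S -> simplex T -> polytope_mod (S `&` T).
Proof.
move=> sS sT; have cT := simplex_closed sT.
case: (sT) => v av Tv; have [a [c H]] := barycentric av.
have TE := conv_hullE H; rewrite -Tv in TE.
pose l i := aff (a i) (c i).
have dec (s : seq 'I_n.+1) : union_of
    (fun S' => simplex S' /\ forall i, i \in s -> one_sided (l i) S') S.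
  elim: s => [|i s IH]; first by apply: union_of1.
  apply: union_of_bind IH => S' [sS' os].
  apply: union_of_bind (simplex_cut (a i) (c i) sS') => S'' [sS'' S''S' oS''].
  apply: union_of1; split=> // j; rewrite inE => /orP[/eqP -> //|/os[] oj].
    by left=> x /S''S'; exact: oj.
  by right=> x /S''S'; exact: oj.
elim: (dec (enum 'I_n.+1)) => [|S' B [sS' os] _ IH].
  by rewrite set0I; exact: polytope_mod0.
rewrite setIUl; apply: polytope_modU => //.
have [S'T|/existsNP[i nS']] := pselect (forall i x, S' x -> 0 <= l i x).
  exists S', set0; split; [exact: union_of1|exact: closed0|exact: interior0|].
  rewrite setU0; apply/setIidPl => x S'x; rewrite TE => i; exact: S'T.
exists set0, (S' `&` T); split; first exact: union_of0.
- by apply: closedI => //; exact: simplex_closed.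
- apply/seteqP; split=> // x xS'; rewrite -(aff_eq0_interior H.2 i).
  apply: interiorS xS' => y [S'y]; rewrite TE => /(_ i) /= l0.
  have [|oi|oi] := os i; first by rewrite mem_enum.
    by case: nS'; exact: oi.
  by apply/eqP; rewrite eq_le l0 (oi y S'y).
- by rewrite set0U.
Qed.

Lemma polytopeI_mod A B : is_polytope A -> is_polytope B -> polytope_mod (A `&` B).
Proof.
move=> /polytope_union_of pA /polytope_union_of pB.
elim: pA => [|S A' sS _ IH]; first by rewrite set0I; exact: polytope_mod0.
rewrite setIUl; apply: polytope_modU => // {IH}.
elim: pB => [|T B' sT _ IH]; first by rewrite setI0; exact: polytope_mod0.
by rewrite setIUr; apply: polytope_modU => //; exact: simplexI_mod.
Qed.

Lemma regclosedU A B : regclosed A -> regclosed B -> regclosed (A `|` B).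
Proof.
move=> rA rB; apply/seteqP; split.
  have cAB : closed (A `|` B) by apply: closedU; exact: regclosed_closed.
  rewrite [X in _ `<=` X]((closure_id _).1 cAB); apply: closureS.
  exact: interior_subset.
rewrite -{1}rA -{1}rB -closureU; apply: closureS; exact: interiorU.
Qed.

Lemma polytope_regclosed A : is_polytope A -> regclosed A.
Proof.
move=> /polytope_union_of; elim=> [|S B sS _ IH].
  by rewrite /regclosed interior0 closure0.
by apply: regclosedU => //; exact: simplex_regclosed.
Qed.

Lemma polytope_closed A : is_polytope A -> closed A.
Proof. by move/polytope_regclosed/regclosed_closed. Qed.

Lemma polytope_regI A B : is_polytope A -> is_polytope B -> is_polytope (regI A B).
Proof.
move=> pA pB; have [U [N [pU cN N0 AB]]] := polytopeI_mod pA pB.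
rewrite /regI AB closure_interior_mod //; first exact/polytope_union_of.
exact/polytope_regclosed/polytope_union_of.
Qed.

End Polytopes.

Section Isometries.
Variables (R : realType) (n : nat).
Local Notation E := 'rV[R]_n.
Implicit Types (x y : E) (A B : set E).

(* Surjectivity, automatic in finite dimension, is made part of the record so
   that inverses are at hand. *)
Record isometry := Isometry {
  isom_fun :> E -> E;
  isom_bij : bijective isom_fun;
  isom_dist : forall x y, edist (isom_fun x) (isom_fun y) = edist x y }.

Implicit Types f g h : isometry.

Lemma isometry_eq f g : (forall x, f x = g x) -> f = g.
Proof.
case: f g => [f bf df] [g bg dg] /= /funext fg; rewrite {}fg in bf df *.
by rewrite (Prop_irrelevance bf bg) (Prop_irrelevance df dg).
Qed.

Definition id_isom : isometry :=
  Isometry (Bijective (frefl id) (frefl id)) (fun x y => erefl (edist x y)).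

Definition comp_isom g f : isometry :=
  @Isometry (g \o f) (bij_comp (isom_bij g) (isom_bij f))
    (fun x y => etrans (isom_dist g (f x) (f y)) (isom_dist f x y)).

Lemma isom_inverse f : exists g : isometry, cancel f g /\ cancel g f.
Proof.
have [f1 fK f1K] := isom_bij f.
have df1 x y : edist (f1 x) (f1 y) = edist x y by rewrite -(isom_dist f) !f1K.
by exists (Isometry (Bijective f1K fK) df1).
Qed.

Definition inv_isom f : isometry := sval (cid (isom_inverse f)).

Lemma isomK f : cancel f (inv_isom f).
Proof. by rewrite /inv_isom; case: cid => g []. Qed.

Lemma isomKV f : cancel (inv_isom f) f.
Proof. by rewrite /inv_isom; case: cid => g []. Qed.

Lemma isom_inj f : injective f.
Proof. exact: can_inj (isomK f). Qed.

Let dot x y : R := \sum_i x 0 i * y 0 i.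

Let dotC x y : dot x y = dot y x.
Proof. by apply: eq_bigr => i _; rewrite mulrC. Qed.

Let dotDl x y z : dot (x + y) z = dot x z + dot y z.
Proof. by rewrite -big_split; apply: eq_bigr => i _; rewrite mxE mulrDl. Qed.

Let dotNl x z : dot (- x) z = - dot x z.
Proof. by rewrite -sumrN; apply: eq_bigr => i _; rewrite mxE mulNr. Qed.

Let dotZl a x z : dot (a *: x) z = a * dot x z.
Proof. by rewrite mulr_sumr; apply: eq_bigr => i _; rewrite mxE mulrA. Qed.

Let dotDr x y z : dot z (x + y) = dot z x + dot z y.
Proof. by rewrite dotC dotDl !(dotC z). Qed.

Let dotNr x z : dot z (- x) = - dot z x.
Proof. by rewrite dotC dotNl (dotC z). Qed.

Let dotZr a x z : dot z (a *: x) = a * dot z x.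
Proof. by rewrite dotC dotZl (dotC z). Qed.

Let dot_eq0 x : dot x x = 0 -> x = 0.
Proof.
move=> /eqP; rewrite psumr_eq0; last by move=> i _; rewrite -expr2 sqr_ge0.
move=> /allP x0; apply/rowP => i; rewrite mxE.
by have := x0 i (mem_index_enum i); rewrite mulf_eq0 orbb => /eqP.
Qed.

Let dotB f x y : dot (f x - f y) (f x - f y) = dot (x - y) (x - y).
Proof.
have sq u v : dot (u - v) (u - v) = edist u v ^+ 2.
  rewrite sqr_sqrtr; last by apply: sumr_ge0 => i _; exact: sqr_ge0.
  by apply: eq_bigr => i _; rewrite !mxE expr2.
by rewrite !sq isom_dist.
Qed.

Let lin f x := f x - f 0.

Let dot_lin f x y : dot (lin f x) (lin f y) = dot x y.
Proof.
have BB u v : dot (u - v) (u - v) = dot u u - dot u v *+ 2 + dot v v.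
  by rewrite !(dotDl, dotDr, dotNl, dotNr) (dotC v u); ring.
have := BB (lin f x) (lin f y); have := BB x y.
rewrite [lin f x - _](_ : _ = f x - f y); last by rewrite /lin opprB addrA subrK.
rewrite dotB => ->; rewrite /lin !dotB !subr0; lra.
Qed.

Let lin_comb f a x y : lin f (a *: x + y) = a *: lin f x + lin f y.
Proof.
apply/eqP; rewrite -subr_eq0; apply/eqP/dot_eq0.
move: (lin f) (dot_lin f) => g dot_g.
rewrite !(dotDl, dotDr, dotNl, dotNr, dotZl, dotZr) !dot_g.
by rewrite !(dotDl, dotDr, dotZl, dotZr) (dotC y x); ring.
Qed.

Let lin0 f : lin f 0 = 0. Proof. exact: subrr. Qed.

Let lin_sum f (I : finType) (t : I -> R) (v : I -> E) :
  lin f (\sum_i t i *: v i) = \sum_i t i *: lin f (v i).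
Proof.
by elim/big_rec2 : _ => [|i y z _ <-]; [exact: lin0|exact: lin_comb].
Qed.

Lemma isom_affine f (I : finType) (t : I -> R) (v : I -> E) :
  \sum_i t i = 1 -> f (\sum_i t i *: v i) = \sum_i t i *: f (v i).
Proof.
move=> t1; rewrite -[LHS](subrK (f 0)) -/(lin f _) lin_sum.
under eq_bigr do rewrite scalerBr.
by rewrite sumrB -scaler_suml t1 scale1r subrK.
Qed.

Lemma isom_continuous f : continuous f.
Proof.
have fE : f = (fun x => \sum_j x 0 j *: lin f (delta_mx 0 j) + f 0) :> (E -> E).
  by apply/funext => x; rewrite -lin_sum -row_sum_delta /lin subrK.
move=> x; rewrite fE; apply: (@cvgD _ _ _ (nbhs x)); last exact: cvg_cst.
apply: (@cvg_big _ _ _ _ _ _ _ (nbhs x)) => [|j _]; first exact: add_continuous.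
apply: (@cvgZ _ _ _ (nbhs x)); last exact: cvg_cst.
exact: coord_continuous.
Qed.

Lemma isom_conv_hull f (v : 'I_n.+1 -> E) : f @` conv_hull v = conv_hull (f \o v).
Proof.
apply/seteqP; split.
  by move=> _ [_ [t [t0 t1] <-] <-]; exists t => //; rewrite isom_affine.
move=> _ [t [t0 t1] <-]; exists (\sum_i t i *: v i); first by exists t.
by rewrite isom_affine.
Qed.

Lemma isom_simplex f S : simplex S -> simplex (f @` S).
Proof.
move=> [v av ->]; exists (f \o v); last exact: isom_conv_hull.
move=> c c0 cv; apply: av => //.
apply: (@dot_eq0); rewrite -(dot_lin f) lin_sum.
under eq_bigr do rewrite scalerBr.
rewrite sumrB -scaler_suml c0 scale0r subr0 cv.
by rewrite /dot big1 // => i _; rewrite mxE mul0r.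
Qed.

Lemma isom_polytope f A : is_polytope A -> is_polytope (f @` A).
Proof.
move=> [I [S [sS ->]]]; exists I, (fun i => f @` S i); split.
  by move=> i; exact: isom_simplex.
exact: image_bigcup.
Qed.

Lemma isom_interior f A : (f @` A)° = f @` A°.
Proof.
by apply: (homeo_interior A (isomK f) (isomKV f)); exact: isom_continuous.
Qed.

Lemma isom_closure f A : closure (f @` A) = f @` closure A.
Proof.
by apply: (homeo_closure A (isomK f) (isomKV f)); exact: isom_continuous.
Qed.

Lemma isom_setI f A B : f @` (A `&` B) = f @` A `&` f @` B.
Proof.
apply/seteqP; split=> [_ [x [Ax Bx] <-]|_ [[x Ax <-] [y By]]].
  by split; exists x.
by move=> /isom_inj yx; exists x => //; split=> //; rewrite -yx.
Qed.

Lemma isom_regI f A B : f @` regI A B = regI (f @` A) (f @` B).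
Proof. by rewrite /regI -isom_setI isom_interior isom_closure. Qed.

Lemma image_isomK f A : inv_isom f @` (f @` A) = A.
Proof.
apply/seteqP; split=> [_ [_ [x Ax <-] <-]|x Ax]; first by rewrite isomK.
by exists (f x); [exists x|rewrite isomK].
Qed.

Lemma image_isomKV f A : f @` (inv_isom f @` A) = A.
Proof.
apply/seteqP; split=> [_ [_ [x Ax <-] <-]|x Ax]; first by rewrite isomKV.
by exists (inv_isom f x); [exists x|rewrite isomKV].
Qed.

Lemma image_isom_interior f A x : (f @` A)° (f x) <-> A° x.
Proof.
rewrite isom_interior; split=> [[y yA /isom_inj <-]//|xA].
by exists x.
Qed.

End Isometries.

Section Covers.
Variables (R : realType) (n : nat).
Local Notation E := 'rV[R]_n.
Local Notation isometry := (isometry R n).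
Implicit Types (x y : E) (P Q S A B : set E).

Definition cover P (I : finType) (F : I -> set E) : Prop :=
  [/\ forall i, is_polytope (F i), \bigcup_i F i = P &
      trivIset setT (fun i => (F i)°)].

Lemma cover_reindex P (I J : finType) (F : I -> set E) (e : J -> I) :
  bijective e -> cover P F -> cover P (F \o e).
Proof.
move=> [e' eK e'K] [pF FP tF]; split=> [i|| i j _ _ /tF ij] /=.
- exact: pF.
- rewrite -FP; apply/seteqP; split=> x [i _ Fx]; first by exists (e i).
  by exists (e' i) => //=; rewrite e'K.
- by apply: (can_inj eK); exact: ij.
Qed.

(* A cover of P together with isometries carrying it to a cover of Q. *)
Record scissors_data P Q := ScissorsData {
  sc_size : nat;
  sc_piece : 'I_sc_size -> set E;
  sc_isom : 'I_sc_size -> isometry;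
  sc_cover : cover P sc_piece;
  sc_cover_image : cover Q (fun i => sc_isom i @` sc_piece i) }.

Arguments sc_piece {P Q} s i.
Arguments sc_isom {P Q} s i.

Definition sc_equiv P Q (a b : scissors_data P Q) : Prop :=
  exists (K : finType) (F : K -> set E), cover P F /\
    forall k, exists i j, [/\ F k `<=` sc_piece a i, F k `<=` sc_piece b j &
                              sc_isom a i = sc_isom b j].

Lemma cover_sub P (I : finType) (F : I -> set E) i : cover P F -> F i `<=` P.
Proof. by move=> [_ <- _] x Fx; exists i. Qed.

Lemma cover_uniq P (I : finType) (F : I -> set E) i j x : cover P F ->
  (F i)° x -> (F j)° x -> i = j.
Proof. by move=> [_ _ tF] Fi Fj; apply: tF => //; exists x. Qed.

Lemma cover_meet P (I : finType) (F : I -> set E) (U : set E) x : cover P F ->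
  P x -> open U -> U x -> exists i y, (F i)° y /\ U y.
Proof.
move=> [pF <- _] [i _ Fx] oU Ux; exists i.
have [y [Fy Uy]] := regclosed_meet (polytope_regclosed (pF i)) oU
  (ex_intro _ x (conj Fx Ux)).
by exists y.
Qed.

Lemma cover_regI P (I : finType) (F : I -> set E) A : cover P F ->
  is_polytope A -> A `<=` P -> \bigcup_i regI A (F i) = A.
Proof.
move=> [pF FP _] pA AP; apply: regI_cover.
- exact: polytope_regclosed.
- by move=> i; exact: polytope_regclosed.
- by rewrite FP.
Qed.

Lemma sc_equivP P Q (a b : scissors_data P Q) : sc_equiv a b <->
  forall i j x, (sc_piece a i)° x -> (sc_piece b j)° x -> sc_isom a i = sc_isom b j.
Proof.
have [ca cb] := (sc_cover a, sc_cover b).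
split=> [[K [F [cF H]]] i j x ai bj|H].
  have Px : P x by apply: (cover_sub ca); exact: interior_subset ai.
  have [k [y [ky [aiy bjy]]]] := cover_meet cF Px
    (openI (@open_interior _ _) (@open_interior _ _)) (conj ai bj).
  have [i' [j' [ki kj ij]]] := H k.
  rewrite (cover_uniq ca aiy (interiorS ki ky)).
  by rewrite (cover_uniq cb bjy (interiorS kj ky)).
have [[pa aP ta] [pb bP tb]] := (ca, cb).
pose F (ij : 'I_(sc_size a) * 'I_(sc_size b)) :=
  regI (sc_piece a ij.1) (sc_piece b ij.2).
exists {ij | `[< F ij !=set0 >]}, (fun k => F (val k)); split; last first.
  move=> [[i j] /= /asboolP[x Fx]]; exists i, j; split.
  - by apply: regI_subl; exact: polytope_closed.
  - by apply: regI_subr; exact: polytope_closed.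
  - have [y [yab _]] := Fx _ (@filterT _ _ _).
    by move: yab; rewrite interiorI => -[ya yb]; exact: H ya yb.
split=> [[[i j] _]||[[i j] ij0] [[i' j'] ij0'] _ _ [x [x1 x2]]] /=.
- exact: polytope_regI.
- apply/seteqP; split=> [x [[[i j] /= _] _]|x Px].
    move=> Fx; apply: (cover_sub (i := i) ca); apply: regI_subl Fx.
    exact: polytope_closed.
  have [i _ ai] : (\bigcup_i sc_piece a i) x by rewrite aP.
  have := ai; rewrite -(cover_regI cb (pa i) (cover_sub ca)) => -[j _ Fx].
  have Fij : `[< F (i, j) !=set0 >] by apply/asboolP; exists x.
  by exists (exist _ (i, j) Fij).
- apply: val_inj => /=.
  have [ai bj] := regI_interior (polytope_closed (pa i)) (polytope_closed (pb j)) x1.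
  have [ai' bj'] :=
    regI_interior (polytope_closed (pa i')) (polytope_closed (pb j')) x2.
  by rewrite (cover_uniq ca ai ai') (cover_uniq cb bj bj').
Qed.

Lemma sc_equiv_refl P Q (a : scissors_data P Q) : sc_equiv a a.
Proof. by apply/sc_equivP => i j x ai /(cover_uniq (sc_cover a) ai) ->. Qed.

Lemma sc_equiv_sym P Q (a b : scissors_data P Q) : sc_equiv a b -> sc_equiv b a.
Proof. by move=> /sc_equivP ab; apply/sc_equivP => i j x bi /ab/(_ bi). Qed.

Lemma sc_equiv_trans P Q (b a c : scissors_data P Q) :
  sc_equiv a b -> sc_equiv b c -> sc_equiv a c.
Proof.
move=> /sc_equivP ab /sc_equivP bc; apply/sc_equivP => i k x ai ck.
have Px : P x by apply: (cover_sub (sc_cover a)); exact: interior_subset ai.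
have [j [y [bj [aiy cky]]]] := cover_meet (sc_cover b) Px
  (openI (@open_interior _ _) (@open_interior _ _)) (conj ai ck).
by rewrite (ab _ _ _ aiy bj) (bc _ _ _ bj cky).
Qed.

Section Data.
Variables (P Q : set E) (I : finType) (F : I -> set E) (g : I -> isometry).
Hypotheses (cF : cover P F) (cgF : cover Q (fun i => g i @` F i)).

Definition mk_data : scissors_data P Q :=
  ScissorsData (cover_reindex (enum_val_bij I) cF)
               (cover_reindex (enum_val_bij I) cgF).

End Data.

Definition comp_piece P Q S (b : scissors_data Q S) (a : scissors_data P Q)
    (ij : 'I_(sc_size a) * 'I_(sc_size b)) : set E :=
  regI (sc_piece a ij.1) (inv_isom (sc_isom a ij.1) @` sc_piece b ij.2).

Definition comp_isoms P Q S (b : scissors_data Q S) (a : scissors_data P Q)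
    (ij : 'I_(sc_size a) * 'I_(sc_size b)) : isometry :=
  comp_isom (sc_isom b ij.2) (sc_isom a ij.1).

Lemma comp_piece_interior P Q S (b : scissors_data Q S) (a : scissors_data P Q)
    (ij : 'I_(sc_size a) * 'I_(sc_size b)) x :
  (comp_piece ij)° x ->
  (sc_piece a ij.1)° x /\ (sc_piece b ij.2)° (sc_isom a ij.1 x).
Proof.
have [[pa _ _] [pb _ _]] := (sc_cover a, sc_cover b).
move=> /regI_interior[||ax bx].
- exact: polytope_closed.
- by apply: polytope_closed; exact: isom_polytope.
by split=> //; rewrite -(image_isom_interior (inv_isom (sc_isom a ij.1))) isomK.
Qed.

Lemma comp_cover P Q S (b : scissors_data Q S) (a : scissors_data P Q) :
  cover P (@comp_piece P Q S b a).
Proof.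
have [[ca cb] cga] := (sc_cover a, sc_cover b, sc_cover_image a).
have [[pa aP _] [pb bQ _]] := (ca, cb).
split=> [[i j]||[i j] [i' j'] _ _ [x [x1 x2]]].
- by apply: polytope_regI => //; exact: isom_polytope.
- apply/seteqP; split=> [x [[i j] _]|x Px].
    move=> Fx; apply: (cover_sub (i := i) ca); apply: regI_subl Fx.
    exact: polytope_closed.
  have [i _ ai] : (\bigcup_i sc_piece a i) x by rewrite aP.
  have gaQ : sc_isom a i @` sc_piece a i `<=` Q := cover_sub (i := i) cga.
  have : (sc_isom a i @` sc_piece a i) (sc_isom a i x) by exists x.
  rewrite -(cover_regI cb _ gaQ); last exact: isom_polytope.
  move=> [j _ Fx]; exists (i, j) => //.
  rewrite /comp_piece /= -{1}(image_isomK (sc_isom a i) (sc_piece a i)).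
  by rewrite -isom_regI; exists (sc_isom a i x) => //; rewrite isomK.
- have [/= a1 b1] := comp_piece_interior x1.
  have [/= a2 b2] := comp_piece_interior x2.
  have ii' := cover_uniq ca a1 a2; move: b2; rewrite -ii' => b2.
  by rewrite (cover_uniq cb b1 b2).
Qed.

Lemma comp_cover_image P Q S (b : scissors_data Q S) (a : scissors_data P Q) :
  cover S (fun ij => @comp_isoms P Q S b a ij @` comp_piece ij).
Proof.
have [[[ca cb] cga] chb] := (sc_cover a, sc_cover b, sc_cover_image a, sc_cover_image b).
have [[pa aP _] [pb bQ _]] := (ca, cb).
have im i j : comp_isoms (i, j) @` @comp_piece P Q S b a (i, j) =
    sc_isom b j @` (regI (sc_isom a i @` sc_piece a i) (sc_piece b j)).
  have -> (A : set E) : comp_isoms (i, j) @` A = sc_isom b j @` (sc_isom a i @` A).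
    by rewrite image_comp.
  by rewrite /comp_piece (isom_regI (sc_isom a i)) /= image_isomKV.
split=> [[i j]||[i j] [i' j'] _ _ [x []]].
- by apply: isom_polytope; apply: polytope_regI => //; exact: isom_polytope.
- apply/seteqP; split=> [x [[i j] _]|x Sx].
    rewrite im => -[y /regI_subr yb <-]; apply: (cover_sub (i := j) chb).
    by exists y => //; apply: yb; exact: polytope_closed.
  have [j _ [y bj <-]] : (\bigcup_j (sc_isom b j @` sc_piece b j)) x.
    by case: (chb) => _ -> _.
  have := bj; rewrite -(cover_regI cga (pb j) (cover_sub cb)) => -[i _ Fy].
  by exists (i, j) => //; rewrite im /regI setIC; exists y.
- rewrite !im !isom_interior => -[y yb <-] [y' yb'].
  have cl i0 : closed (sc_isom a i0 @` sc_piece a i0).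
    by apply: polytope_closed; exact: isom_polytope.
  have [a1 b1] := regI_interior (cl i) (polytope_closed (pb j)) yb.
  have [a2 b2] := regI_interior (cl i') (polytope_closed (pb j')) yb'.
  move=> yy.
  have jj' : j = j'.
    apply: (cover_uniq (x := sc_isom b j y) chb).
      by apply/image_isom_interior.
    by rewrite -yy; apply/image_isom_interior.
  move: yy b2; rewrite -jj' => /isom_inj yy _; rewrite yy in a2.
  by rewrite (cover_uniq cga a1 a2).
Qed.

(* [comp_data b a] is a followed by b, on the common refinement of the image
   cover of a and the source cover of b *)
Definition comp_data P Q S (b : scissors_data Q S) (a : scissors_data P Q) :
  scissors_data P S := mk_data (comp_cover b a) (comp_cover_image b a).

Lemma comp_dataP P Q S (b : scissors_data Q S) (a : scissors_data P Q) k x :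
  (sc_piece (comp_data b a) k)° x -> exists i j,
    [/\ (sc_piece a i)° x, (sc_piece b j)° (sc_isom a i x) &
        sc_isom (comp_data b a) k = comp_isom (sc_isom b j) (sc_isom a i)].
Proof.
by move=> /comp_piece_interior[ai bj]; exists (enum_val k).1, (enum_val k).2.
Qed.

Lemma inv_cover P Q (a : scissors_data P Q) :
  cover P (fun i => inv_isom (sc_isom a i) @` (sc_isom a i @` sc_piece a i)).
Proof.
rewrite (_ : (fun _ => _) = @sc_piece P Q a); first exact: sc_cover.
by apply/funext => i; rewrite image_isomK.
Qed.

Definition inv_data P Q (a : scissors_data P Q) : scissors_data Q P :=
  ScissorsData (sc_cover_image a) (inv_cover a).

Lemma id_cover P : is_polytope P -> cover P (fun _ : 'I_1 => P).
Proof.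
move=> pP; split=> // [|i j _ _ _]; last by rewrite !ord1.
by apply/seteqP; split=> [x [i _]//|x Px]; exists 0.
Qed.

Lemma id_cover_image P : is_polytope P ->
  cover P (fun _ : 'I_1 => id_isom R n @` P).
Proof. by move=> pP; rewrite image_id; exact: id_cover. Qed.

Definition id_data P (pP : is_polytope P) : scissors_data P P :=
  ScissorsData (id_cover pP) (id_cover_image pP).

Lemma comp_data_equiv P Q S (b b' : scissors_data Q S) (a a' : scissors_data P Q) :
  sc_equiv b b' -> sc_equiv a a' -> sc_equiv (comp_data b a) (comp_data b' a').
Proof.
move=> /sc_equivP bb /sc_equivP aa; apply/sc_equivP => k k' x.
move=> /comp_dataP[i [j [ai bj ->]]] /comp_dataP[i' [j' [ai' bj' ->]]].
by move: bj; rewrite (aa _ _ _ ai ai') => bj; rewrite (bb _ _ _ bj bj').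
Qed.

Lemma inv_data_equiv P Q (a a' : scissors_data P Q) :
  sc_equiv a a' -> sc_equiv (inv_data a) (inv_data a').
Proof.
move=> /sc_equivP aa; apply/sc_equivP => i j y /= yi yj.
pose U := (sc_isom a i @` sc_piece a i)° `&` (sc_isom a' j @` sc_piece a' j)°.
have oU : open (sc_isom a i @^-1` U).
  have /continuousP := @isom_continuous R n (sc_isom a i); apply.
  by apply: openI; exact: open_interior.
have [x xi xy] : (sc_isom a i @` (sc_piece a i)°) y by rewrite -isom_interior.
have Px : P x by apply: (cover_sub (sc_cover a)); exact: interior_subset xi.
have [|k [z [zk [/image_isom_interior zi zj]]]] := cover_meet (sc_cover a') Px oU.
  by rewrite /U /= xy.
have ik := aa _ _ _ zi zk; congr inv_isom; rewrite ik; congr sc_isom.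
apply: (cover_uniq (x := sc_isom a i z) (sc_cover_image a')) => //.
by rewrite ik; apply/image_isom_interior.
Qed.

End Covers.

Arguments sc_piece {R n P Q} s i.
Arguments sc_isom {R n P Q} s i.

Section ScissorsCongruence.
Variables (R : realType) (n : nat).
Local Notation E := 'rV[R]_n.

Record polytope := Polytope {
  polytope_set :> set E;
  polytopeP : is_polytope polytope_set }.

HB.instance Definition _ (P Q : set E) := gen_eqMixin (scissors_data P Q).
HB.instance Definition _ (P Q : set E) := gen_choiceMixin (scissors_data P Q).

Definition sc_equivb (P Q : set E) (a b : scissors_data P Q) : bool :=
  `[< sc_equiv a b >].

Section Quotient.
Variables P Q : set E.

Let sc_equivb_refl : reflexive (@sc_equivb P Q).
Proof. by move=> a; apply/asboolP; exact: sc_equiv_refl. Qed.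

Let sc_equivb_sym : symmetric (@sc_equivb P Q).
Proof.
by move=> a b; apply/idP/idP => /asboolP ab; apply/asboolP; exact: sc_equiv_sym.
Qed.

Let sc_equivb_trans : transitive (@sc_equivb P Q).
Proof.
move=> b a c /asboolP ab /asboolP bc; apply/asboolP.
exact: sc_equiv_trans ab bc.
Qed.

Canonical sc_equivb_equiv_rel :=
  EquivRel (@sc_equivb P Q) sc_equivb_refl sc_equivb_sym sc_equivb_trans.

Local Open Scope quotient_scope.

Definition scissors_congruence : Type := {eq_quot (@sc_equivb P Q)}.
HB.instance Definition _ := Choice.on scissors_congruence.
HB.instance Definition _ := EqQuotient.on scissors_congruence.

Definition sc_class (a : scissors_data P Q) : scissors_congruence :=
  \pi_scissors_congruence a.

Lemma sc_classP a b : sc_class a = sc_class b <-> sc_equiv a b.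
Proof.
split=> [/eqmodP/asboolP//|ab].
by apply/eqmodP/asboolP.
Qed.

Lemma sc_class_repr (x : scissors_congruence) : sc_class (repr x) = x.
Proof. exact: reprK. Qed.

Lemma sc_repr_class a : sc_equiv (repr (sc_class a)) a.
Proof. by apply/sc_classP; exact: sc_class_repr. Qed.

End Quotient.

Definition sc_comp (P Q S : set E) (y : scissors_congruence Q S)
    (x : scissors_congruence P Q) : scissors_congruence P S :=
  sc_class (comp_data (repr y) (repr x)).

Definition sc_inv (P Q : set E) (x : scissors_congruence P Q) :
    scissors_congruence Q P :=
  sc_class (inv_data (repr x)).

Lemma sc_compE (P Q S : set E) (b : scissors_data Q S) (a : scissors_data P Q) :
  sc_comp (sc_class b) (sc_class a) = sc_class (comp_data b a).
Proof. by apply/sc_classP; apply: comp_data_equiv; exact: sc_repr_class. Qed.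

Lemma sc_invE (P Q : set E) (a : scissors_data P Q) :
  sc_inv (sc_class a) = sc_class (inv_data a).
Proof. by apply/sc_classP; apply: inv_data_equiv; exact: sc_repr_class. Qed.

Definition Aut (P : polytope) : Type := scissors_congruence P P.

Section AutGroup.
Variable P : polytope.
HB.instance Definition _ := Choice.on (Aut P).

Let one : Aut P := sc_class (id_data (polytopeP P)).

Let mulA : associative (@sc_comp P P P : Aut P -> Aut P -> Aut P).
Proof.
move=> z y x; rewrite -(sc_class_repr x) -(sc_class_repr y) -(sc_class_repr z).
rewrite !sc_compE; apply/sc_classP/sc_equivP => k k' u.
move=> /comp_dataP[k1 [l [/comp_dataP[i [j [xi yj E1]]] zl ->]]].
move=> /comp_dataP[i' [k2 [xi' /comp_dataP[j' [l' [yj' zl' E2]]] ->]]].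
rewrite E1 /= in zl; rewrite E1 E2; apply: isometry_eq => v /=.
have ii := cover_uniq (sc_cover _) xi xi'; rewrite -ii in yj' zl' *.
have jj := cover_uniq (sc_cover _) yj yj'; rewrite -jj in zl' *.
by rewrite (cover_uniq (sc_cover _) zl zl').
Qed.

Let mul1 : left_id one (@sc_comp P P P).
Proof.
move=> x; rewrite -(sc_class_repr x) sc_compE; apply/sc_classP/sc_equivP.
move=> k i u /comp_dataP[i' [j [xi' _ ->]]] xi.
by rewrite (cover_uniq (sc_cover _) xi xi'); exact: isometry_eq.
Qed.

Let mulr1 : right_id one (@sc_comp P P P).
Proof.
move=> x; rewrite -(sc_class_repr x) sc_compE; apply/sc_classP/sc_equivP.
move=> k i u /comp_dataP[j [i' [_ /= xi' ->]]] xi.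
by rewrite (cover_uniq (sc_cover _) xi xi'); exact: isometry_eq.
Qed.

Let mulV : left_inverse one (@sc_inv P P) (@sc_comp P P P).
Proof.
move=> x; rewrite -(sc_class_repr x) sc_invE sc_compE; apply/sc_classP/sc_equivP.
move=> k i u /comp_dataP[j [i' [/= xj xi ->]]] _; apply: isometry_eq => v /=.
move/(@image_isom_interior _ _ (sc_isom (repr x) j)) in xj.
by rewrite -(cover_uniq (sc_cover_image (repr x)) xj xi) isomK.
Qed.

Let mulrV : right_inverse one (@sc_inv P P) (@sc_comp P P P).
Proof.
move=> x; rewrite -(sc_class_repr x) sc_invE sc_compE; apply/sc_classP/sc_equivP.
move=> k i u /comp_dataP[i' [j [/= xi xj ->]]] _; apply: isometry_eq => v /=.
rewrite isom_interior in xi; case: xi xj => w xi' <-; rewrite isomK => xj.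
by rewrite (cover_uniq (sc_cover _) xi' xj) isomKV.
Qed.

HB.instance Definition _ := isGroup.Build (Aut P) mulA mul1 mulr1 mulV mulrV.

Lemma Aut_mulE (x y : Aut P) : (x * y)%g = sc_comp x y.
Proof. by []. Qed.

Lemma Aut_invE (x : Aut P) : (x^-1)%g = sc_inv x.
Proof. by []. Qed.

Lemma Aut_1E : (1 : Aut P)%g = sc_class (id_data (polytopeP P)).
Proof. by []. Qed.

End AutGroup.

End ScissorsCongruence.

Section GroupTheory.
Variable G : groupType.
Local Open Scope group_scope.

Definition is_subgroup (H : set G) : Prop :=
  [/\ H 1, forall x y, H x -> H y -> H (x * y) & forall x, H x -> H x^-1].

Definition commutator_subgroup (H : set G) : set G :=
  smallest is_subgroup [set [~ x, y] | x in H & y in H].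

Definition perfect (H : set G) : Prop := commutator_subgroup H = H.

Definition quasi_perfect : Prop := perfect (commutator_subgroup setT).

End GroupTheory.

(* Main.v *)
From Pilot Require Import Defs.
From mathcomp Require Import all_boot all_order all_algebra.
From mathcomp Require Import generic_quotient.
From mathcomp Require Import all_classical all_reals all_analysis.
From mathcomp Require Import ring lra.

(** Let G be the scissors automorphism group of P.  The commutator subgroup of
    G is perfect as soon as every commutator of G lies in the second derived
    subgroup G'', and since G'' is normal it is enough to check this on a set of
    generators ([commutator_generators]).

    Fix a box W inside P and divide the rest of P into cells that are tiny
    compared with W.  An automorphism is [small] if it is the identity outside
    W and one cell.  Two facts prove the theorem.

    - Small automorphisms commute modulo G'' ([small_commutator]).  If a and b
      are small, W and the two cells concerned can be moved off themselves
      inside P in two disjoint ways, by h and by k.  Then the conjugates of a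
      by h and of b by k commute with each other and with a and b, and so
      [a, b] is the commutator of two commutators, one built from a and h, the
      other from b and k ([commutator_displaced]).

    - Small automorphisms generate G ([small_generates]).  Given g, the cells
      are treated one at a time.  Suppose that h, obtained from g by composing
      with small automorphisms, is the identity on the cells treated so far,
      and let A be the next cell.  Cut A into pieces on which h is an isometry
      with image in a single cell.
      If the pieces can be copied into W without meeting one another or h A,
      then exchanging each h Z with the copy of the piece Z, and afterwards
      each copy with Z itself, corrects h to the identity on A.  Each exchange
      is small, and none of them touches a treated cell
      ([fragment_step]).  After the last cell the automorphism is supported in
      W, hence small.

    Copies that avoid h A exist for reasons of volume, which are made precise by
    counting boxes ([room]).  Divide A into grid cells of side 2 eps and take in
    W a family of boxes of the same size, with centres 6 eps apart.  A box that
    meets h A gives a point of a piece of A, and two boxes that meet the image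
    of the same piece give points that are far apart on the scale eps, because
    isometries distort the sup norm by a factor n at most.  Moving all these
    points well inside their pieces ([push_inside]) keeps points of one piece
    apart and, once eps is small, separates those of different pieces,
    whatever their shapes.  So the number of boxes that meet h A is at most a
    constant times the number of grid cells of A ([occupied_card]), and if W
    is large enough there remains one free box for each grid cell.

    Scissors automorphisms are handled through the functions that they define
    off a closed set with empty interior ([act]); identities between such
    functions are stated at generic points, i.e. along the filter [generic]. *)

Set Implicit Arguments.
Unset Strict Implicit.
Unset Printing Implicit Defensive.

Import Order.TTheory GRing.Theory Num.Theory numFieldNormedType.Exports.
(* a second time, because [isometry] also names a notion of sesquilinear forms *)
Import Pilot.Defs.

Local Open Scope classical_set_scope.
Local Open Scope ring_scope.

(** * Generic points *)

Section Generic.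
Variables (R : realType) (n : nat).
Local Notation E := 'rV[R]_n.
Implicit Types (A B Q : set E) (f g : isometry R n).

(** The sets whose complement lies in one closed nowhere dense set. They
    form a filter because finite unions of closed sets with empty interior have
    empty interior. *)
Definition generic : set_system E :=
  [set Q | exists N, [/\ closed N, N° = set0 & ~` N `<=` Q]].

Global Instance generic_filter : Filter generic.
Proof.
split.
- by exists set0; split; [exact: closed0|exact: interior0|].
- move=> Q Q' [N [cN N0 NQ]] [M [cM M0 MQ]]; exists (N `|` M); split.
  + exact: closedU.
  + exact: interior0U.
  + by rewrite setCU => x [/NQ ? /MQ].
- by move=> Q Q' QQ' [N [cN N0 NQ]]; exists N; split=> // x /NQ/QQ'.
Qed.

Lemma generic_isom f Q : (\forall x \near generic, Q x) ->
  \forall x \near generic, Q (f x).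
Proof.
move=> [N [cN N0 NQ]]; exists (f @^-1` N); split.
- by apply: closed_comp cN => x _; exact: isom_continuous.
- rewrite (_ : _ @^-1` _ = inv_isom f @` N).
    by rewrite isom_interior N0 image_set0.
  apply/seteqP; split=> [x Nx|_ [y Ny <-]] /=; last by rewrite isomKV.
  by exists (f x) => //; rewrite isomK.
- by move=> x; exact: NQ.
Qed.

Lemma generic_open (U Q : set E) : (\forall x \near generic, Q x) -> open U ->
  U !=set0 -> exists2 x, U x & Q x.
Proof.
move=> [N [cN N0 NQ]] oU [x Ux]; apply: contrapT => H.
suff : N° x by rewrite N0.
apply: (@filterS _ _ _ U); last exact: open_nbhs_nbhs.
by move=> y Uy; apply: contrapT => /NQ Qy; apply: H; exists y.
Qed.

Lemma generic_interior A : closed A -> \forall x \near generic, A x -> A° x.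
Proof.
move=> cA; exists (A `\` A°); split.
- by rewrite setDE; apply: closedI => //; apply: open_closedC; exact: open_interior.
- apply/seteqP; split=> // x xA.
  have [_] := interior_subset xA; apply.
  by apply: interiorS xA => y [].
- by move=> x nA Ax; apply: contrapT => nAo; apply: nA.
Qed.

(** Polytopes are the closures of their interiors, so between them a generic
    inclusion is an inclusion. *)
Lemma generic_sub A B : regclosed A -> closed B ->
  (\forall x \near generic, A x -> B x) -> A `<=` B.
Proof.
move=> rA cB AB; rewrite -rA ((closure_id B).1 cB) => x xA V /= xV.
have [y [yA yV]] := xA _ (nbhs_interior xV).
have [|z [zA zV] ABz] := 
  generic_open AB (openI (@open_interior _ A) (@open_interior _ V)).
  by exists y.
by exists z; split; [apply: ABz; exact: interior_subset|exact: interior_subset].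
Qed.

Lemma generic_disjoint A B : (\forall x \near generic, ~ (A x /\ B x)) ->
  A° `&` B° = set0.
Proof.
move=> AB; apply/seteqP; split=> // x xAB.
have [|y [yA yB]] := 
  generic_open AB (openI (@open_interior _ A) (@open_interior _ B)).
  by exists x.
by apply; split; exact: interior_subset.
Qed.

Lemma generic_nonzero a c : [set x : E | aff a c x = 0]° = set0 ->
  \forall x \near generic, aff a c x != 0.
Proof.
move=> l0; exists [set x | aff a c x = 0]; split=> //; last first.
  by move=> x /= lx; apply/eqP.
by apply: (closed_comp _ (@closed_eq R 0)) => x _; exact: aff_continuous.
Qed.

(** An affine map is determined on a whole line by two of its points, and any
    segment from a point of U starts inside U. *)
Lemma isom_eq_open f g (U : set E) : open U -> U !=set0 ->
  (\forall x \near generic, U x -> f x = g x) -> f = g.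
Proof.
move=> oU [x0 Ux0] fg.
pose D := [set x | f x = g x].
have cD : closed D.
  rewrite (_ : D = (fun x => f x - g x) @^-1` [set 0]); last first.
    by apply/seteqP; split=> x /=; [move=> ->; exact: subrr|move/subr0_eq].
  apply: closed_comp; last first.
    exact/accessible_closed_set1/hausdorff_accessible/norm_hausdorff.
  by move=> x _; apply: (@cvgB _ _ _ (nbhs x)); exact: isom_continuous.
have UD x : U x -> D x.
  move=> Ux; rewrite ((closure_id D).1 cD) => V /= xV.
  have [|z [zU zV] fgz] := generic_open fg (openI oU (@open_interior _ V)).
    by exists x; split=> //; exact: nbhs_interior.
  by exists z; split; [exact: fgz|exact: interior_subset].
apply: isometry_eq => y.
have [e /andP[e0 e1] Ue] := segment_nbhs y (open_nbhs_nbhs (conj oU Ux0)).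
have mid (h : isometry R n) :
    h ((1 - e) *: x0 + e *: y) = (1 - e) *: h x0 + e *: h y.
  have := @isom_affine R n h bool (fun b => if b then e else 1 - e)
    (fun b => if b then y else x0).
  rewrite !big_bool /= addrC subrK => /(_ erefl).
  by rewrite ![e *: _ + _]addrC.
have := UD _ Ue; rewrite /D /= !mid (UD _ Ux0) => /addrI.
by move/(scalerI (lt0r_neq0 e0)).
Qed.

End Generic.

Arguments generic {R n}.

(** * Cutting polytopes *)

Section Cuttable.
Variables (R : realType) (n : nat).
Local Notation E := 'rV[R]_n.
Implicit Types (A B C : set E).

Lemma polytope0 : is_polytope (set0 : set E).
Proof. by apply/polytope_union_of; exact: union_of0. Qed.

Lemma polytopeU A B : is_polytope A -> is_polytope B -> is_polytope (A `|` B).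
Proof.
by move=> /polytope_union_of pA /polytope_union_of pB; apply/polytope_union_of;
  exact: union_of_setU.
Qed.

Lemma simplex_polytope A : simplex A -> is_polytope A.
Proof. by move=> sA; apply/polytope_union_of; exact: union_of1. Qed.

(** Boolean combinations of polytopes are polytopes only up to lower-dimensional
    parts. Asking for both A meet B and A minus B makes the property stable
    under complements, so that half-spaces generate all the cases needed. *)
Definition cuttable B := forall A, is_polytope A -> exists C D,
  [/\ is_polytope C, is_polytope D,
      \forall x \near generic, C x <-> A x /\ B x &
      \forall x \near generic, D x <-> A x /\ ~ B x].

(** The simplices of A can be subdivided into simplices on which the affine
    function has constant sign; the nondegeneracy hypothesis makes its zero set
    negligible. *)
Lemma cuttable_halfspace a c : [set x : E | aff a c x = 0]° = set0 ->
  cuttable [set x | 0 <= aff a c x].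
Proof.
move=> l0 A /polytope_union_of pA.
have : union_of (fun S => simplex S /\ one_sided (aff a c) S) A.
  apply: union_of_bind pA => S /(simplex_cut a c); apply: union_of_bind.
  by move=> S' [sS' _ oS']; apply: union_of1.
elim=> [|S B [sS oS] _ [C [D [pC pD CB DB]]]].
  by exists set0, set0; split; try exact: polytope0; near=> x; split=> // -[].
have pS := simplex_polytope sS; case: oS => oS.
- exists (S `|` C), D; split=> //; first exact: polytopeU.
    near=> x; have Cx : C x <-> B x /\ 0 <= aff a c x by near: x.
    split=> [[Sx|/Cx[]]|[[]]] /=; [by split; [left|exact: oS]|by split; [right|]
      |by left|by right; apply/Cx].
  near=> x; have Dx : D x <-> B x /\ ~ (0 <= aff a c x) by near: x.
  by split=> [/Dx[]|[[/oS//|Bx] nx]] /=; [split; [right|]|apply/Dx].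
- exists C, (S `|` D); split=> //; first exact: polytopeU.
    near=> x; have Cx : C x <-> B x /\ 0 <= aff a c x by near: x.
    have xn : aff a c x != 0 by near: x; exact: generic_nonzero.
    split=> [/Cx[]|[[/oS Sx|Bx] nx]] /=; [by split; [right|]| |exact/Cx].
    by move: xn; rewrite eq_le Sx (nx : 0 <= _).
  near=> x; have Dx : D x <-> B x /\ ~ (0 <= aff a c x) by near: x.
  have xn : aff a c x != 0 by near: x; exact: generic_nonzero.
  split=> [[Sx|/Dx[]]|[[|Bx] nx]] /=; [|by split; [right|]|by left|by right; apply/Dx].
  split; first by left.
  by move=> x0; move: xn; rewrite eq_le (oS _ Sx) x0.
Unshelve. all: by end_near. Qed.

Lemma cuttableC B : cuttable B -> cuttable (~` B).
Proof.
move=> cB A /cB[C [D [pC pD CB DB]]]; exists D, C; split=> //.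
near=> x; have -> : C x <-> A x /\ B x by near: x.
by split=> [[Ax Bx]|[Ax /contrapT Bx]]; split=> // nB; exact: nB.
Unshelve. all: by end_near. Qed.

Lemma cuttableI B B' : cuttable B -> cuttable B' -> cuttable (B `&` B').
Proof.
move=> cB cB' A /cB[C [D [pC pD CB DB]]].
have [C' [D' [pC' pD' CB' DB']]] := cB' _ pC.
exists C', (D `|` D'); split=> //; first exact: polytopeU.
  near=> x.
  have -> : C' x <-> C x /\ B' x by near: x.
  have -> : C x <-> A x /\ B x by near: x.
  by split=> [[[]]|[? []]].
near=> x.
have H1 : D' x <-> C x /\ ~ B' x by near: x.
have H2 : C x <-> A x /\ B x by near: x.
have H3 : D x <-> A x /\ ~ B x by near: x.
have := pselect (B x); have := pselect (B' x); rewrite /setU /setI /=; tauto.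
Unshelve. all: by end_near. Qed.

Lemma cuttable_setT : cuttable setT.
Proof.
by move=> A pA; exists A, set0; split=> //; [exact: polytope0| |]; near=> x;
  split=> //; [move=> []|move=> [_]; apply].
Unshelve. all: by end_near. Qed.

Lemma cuttable_fin (I : finType) (B : I -> set E) :
  (forall i, cuttable (B i)) -> cuttable [set x | forall i, B i x].
Proof.
move=> cB; suff H (s : seq I) : cuttable [set x | forall i, i \in s -> B i x].
  rewrite (_ : [set _ | _] = [set x | forall i, i \in enum I -> B i x]) //.
  by apply/seteqP; split=> x /= H' i; [move=> _|]; apply: H'; rewrite ?mem_enum.
elim: s => [|i s IH].
  by rewrite (_ : [set _ | _] = setT); [exact: cuttable_setT|exact/seteqP].
rewrite (_ : [set _ | _] = B i `&` [set x | forall i, i \in s -> B i x]).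
  exact: cuttableI.
apply/seteqP; split=> x /= => [H|[Bi H] j]; last by rewrite inE => /orP[/eqP ->//|/H].
by split=> [|j js]; apply: H; rewrite inE ?eqxx ?js ?orbT.
Qed.

Lemma cuttable_polytope B : is_polytope B -> cuttable B.
Proof.
move=> /polytope_union_of; elim=> [|S {}B sS _ cB].
  by rewrite -setCT; exact/cuttableC/cuttable_setT.
rewrite -(setCK (S `|` B)) setCU; apply/cuttableC/cuttableI; apply: cuttableC => //.
case: sS => v av ->; have [a [c H]] := barycentric av; rewrite (conv_hullE H).
apply: cuttable_fin => i; apply: cuttable_halfspace.
exact: aff_eq0_interior H.2 i.
Qed.

Lemma polytope_meet A B : is_polytope A -> cuttable B ->
  exists2 C, is_polytope C & \forall x \near generic, C x <-> A x /\ B x.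
Proof. by move=> pA /(_ A pA)[C [_ [? _ ? _]]]; exists C. Qed.

Lemma polytope_diff A B : is_polytope A -> cuttable B ->
  exists2 C, is_polytope C & \forall x \near generic, C x <-> A x /\ ~ B x.
Proof. by move=> pA /(_ A pA)[_ [C [_ ? _ ?]]]; exists C. Qed.

End Cuttable.

(** * Scissors automorphisms as functions at generic points *)

Section Action.
Variables (R : realType) (n : nat).
Local Notation E := 'rV[R]_n.

Section Data.
Variables P Q : set E.
Implicit Types (d : scissors_data P Q).

Definition data_fun d (x : E) : E :=
  if [pick i | `[< (sc_piece d i)° x >]] is Some i then sc_isom d i x else x.

Lemma data_funE d i x : (sc_piece d i)° x -> data_fun d x = sc_isom d i x.
Proof.
rewrite /data_fun => xi; case: pickP => [j /asboolP xj|/(_ i)/asboolP//].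
by rewrite (cover_uniq (sc_cover d) xi xj).
Qed.

Lemma data_fun_out d x : ~ P x -> data_fun d x = x.
Proof.
rewrite /data_fun => nPx; case: pickP => // i /asboolP /interior_subset xi.
by case: nPx; exact: (cover_sub (sc_cover d)) xi.
Qed.

Lemma generic_piece d : \forall x \near generic,
  forall i, sc_piece d i x -> (sc_piece d i)° x.
Proof.
apply: filter_forall => i; apply: generic_interior.
by apply: polytope_closed; case: (sc_cover d).
Qed.

Lemma data_fun_near d : \forall x \near generic,
  forall i, sc_piece d i x -> data_fun d x = sc_isom d i x.
Proof. by have := generic_piece d; apply: filterS => x H i /H; exact: data_funE. Qed.

(** The function is locally one of finitely many isometries, and these preserve
    generic statements. *)
Lemma data_fun_pull d (S : set E) : (\forall x \near generic, S x) ->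
  \forall x \near generic, S (data_fun d x).
Proof.
move=> gS; have := filter_forall _ (fun i => generic_isom (sc_isom d i) gS).
move=> H; near=> x; rewrite /data_fun; case: pickP => [i _|_]; last by near: x.
by move: i; near: x; exact: H.
Unshelve. all: by end_near. Qed.

(** Equivalence of scissors data is equality of the local isometries wherever two
    pieces overlap, which the values near one point determine. *)
Lemma data_fun_eq d d' :
  (\forall x \near generic, data_fun d x = data_fun d' x) <-> sc_equiv d d'.
Proof.
rewrite sc_equivP; split=> [H i j x xi xj|H].
  apply: (isom_eq_open (U := (sc_piece d i)° `&` (sc_piece d' j)°)).
  - by apply: openI; exact: open_interior.
  - by exists x.
  - by move: H; apply: filterS => y + [yi yj]; rewrite (data_funE yi) (data_funE yj).
near=> x; have [Px|nPx] := pselect (P x); last by rewrite !data_fun_out.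
have [i _ xi] : (\bigcup_i sc_piece d i) x by case: (sc_cover d) => _ -> _.
have [j _ xj] : (\bigcup_i sc_piece d' i) x by case: (sc_cover d') => _ -> _.
have xi' : (sc_piece d i)° x by move: i xi; near: x; exact: generic_piece.
have xj' : (sc_piece d' j)° x by move: j xj; near: x; exact: generic_piece.
by rewrite (data_funE xi') (data_funE xj') (H _ _ _ xi' xj').
Unshelve. all: by end_near. Qed.

End Data.

Section Aut.
Variable P : polytope R n.
Local Notation "|P|" := (polytope_set P).
Implicit Types (a b : Aut P) (S X Y : set E).

Definition act a : E -> E := data_fun (repr a).

Lemma act_class (d : scissors_data P P) :
  \forall x \near generic, act (sc_class d) x = data_fun d x.
Proof. by apply/data_fun_eq; exact: sc_repr_class. Qed.

Lemma act_inj a b : (\forall x \near generic, act a x = act b x) -> a = b.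
Proof. by move=> /data_fun_eq/sc_classP; rewrite !sc_class_repr. Qed.

Lemma act_pull a S : (\forall x \near generic, S x) ->
  \forall x \near generic, S (act a x).
Proof. exact: data_fun_pull. Qed.

Lemma act_out a x : ~ |P| x -> act a x = x.
Proof. exact: data_fun_out. Qed.

Lemma actM a b : \forall x \near generic, act (a * b)%g x = act a (act b x).
Proof.
rewrite Aut_mulE /sc_comp; set d := comp_data _ _.
near=> x; have -> : act (sc_class d) x = data_fun d x by near: x; exact: act_class.
have [Px|nPx] := pselect (|P| x); last by rewrite !(data_fun_out, act_out).
have [i _ xi] : (\bigcup_i sc_piece d i) x by case: (sc_cover d) => _ -> _.
have xi' : (sc_piece d i)° x by move: i xi; near: x; exact: generic_piece.
have [j [k [xj xk dE]]] := comp_dataP xi'.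
by rewrite (data_funE xi') dE /act (data_funE xj) (data_funE xk).
Unshelve. all: by end_near. Qed.

Lemma act1 : \forall x \near generic, act 1%g x = x.
Proof.
rewrite Aut_1E; set d := id_data _; near=> x.
have -> : act (sc_class d) x = data_fun d x by near: x; exact: act_class.
by rewrite /data_fun; case: pickP.
Unshelve. all: by end_near. Qed.

Lemma actK a : \forall x \near generic, act a^-1%g (act a x) = x.
Proof.
near=> x; have <- : act (a^-1 * a)%g x = act a^-1%g (act a x).
  by near: x; exact: actM.
by rewrite mulVg; near: x; exact: act1.
Unshelve. all: by end_near. Qed.

Lemma actKV a : \forall x \near generic, act a (act a^-1%g x) = x.
Proof. by have := actK a^-1%g; rewrite invgK. Qed.

Definition supp a X := \forall x \near generic, ~ X x -> act a x = x.

Lemma supp_sub a X Y : (\forall x \near generic, X x -> Y x) ->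
  supp a X -> supp a Y.
Proof.
rewrite /supp => XY sa; near=> x => nY.
have ax : ~ X x -> act a x = x by near: x.
have XYx : X x -> Y x by near: x.
by apply: ax => /XYx.
Unshelve. all: by end_near. Qed.

Lemma suppV a X : supp a X -> supp a^-1%g X.
Proof.
move=> sa; rewrite /supp; near=> x => nX.
have ax : act a x = x by move: nX; near: x.
by rewrite -[in LHS]ax; near: x; exact: actK.
Unshelve. all: by end_near. Qed.

(** A point of X sent outside X would be fixed by the inverse of a, which has
    the same support. *)
Lemma supp_stable a X : supp a X -> \forall x \near generic, X x -> X (act a x).
Proof.
move=> sa; near=> x => Xx; apply: contrapT => nX.
have ax : act a^-1%g (act a x) = act a x.
  by move: nX; near: x; exact: (act_pull a (suppV sa)).
apply: nX; rewrite -ax; have -> // : act a^-1%g (act a x) = x.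
by near: x; exact: actK.
Unshelve. all: by end_near. Qed.

Lemma supp_commute a b X Y : supp a X -> supp b Y ->
  (\forall x \near generic, ~ (X x /\ Y x)) -> commute a b.
Proof.
move=> sa sb XY; apply: act_inj; near=> x.
have -> : act (a * b)%g x = act a (act b x) by near: x; exact: actM.
have -> : act (b * a)%g x = act b (act a x) by near: x; exact: actM.
have nXY : ~ (X x /\ Y x) by near: x.
have ax : ~ X x -> act a x = x by near: x.
have bx : ~ Y x -> act b x = x by near: x.
have ab : ~ X (act b x) -> act a (act b x) = act b x.
  by near: x; exact: (act_pull b sa).
have ba : ~ Y (act a x) -> act b (act a x) = act a x.
  by near: x; exact: (act_pull a sb).
have nXYb : ~ (X (act b x) /\ Y (act b x)) by near: x; exact: (act_pull b XY).
have nXYa : ~ (X (act a x) /\ Y (act a x)) by near: x; exact: (act_pull a XY).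
have Xa : X x -> X (act a x) by near: x; exact: (supp_stable sa).
have Yb : Y x -> Y (act b x) by near: x; exact: (supp_stable sb).
have [Xx|nX] := pselect (X x).
  rewrite bx; first by rewrite ba // => Ya; apply: nXYa; split=> //; exact: Xa.
  by move=> Yx; apply: nXY.
rewrite (ax nX); have [Yx|nY] := pselect (Y x).
  by rewrite ab // => Xb; apply: nXYb; split=> //; exact: Yb.
by rewrite bx // ax.
Unshelve. all: by end_near. Qed.

(** Here [a ^ h^-1] is h a h^-1, the conjugate of a by h. *)
Lemma supp_conj a h X Y : supp a X ->
  (\forall x \near generic, X x -> Y (act h x)) -> supp (a ^ h^-1)%g Y.
Proof.
move=> sa XY; rewrite /supp conjgE invgK; near=> y => nY.
have -> : act (h * (a * h^-1))%g y = act h (act (a * h^-1)%g y).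
  by near: y; exact: actM.
have -> : act (a * h^-1)%g y = act a (act h^-1%g y) by near: y; exact: actM.
have hy : act h (act h^-1%g y) = y by near: y; exact: actKV.
have ax : ~ X (act h^-1%g y) -> act a (act h^-1%g y) = act h^-1%g y.
  by near: y; exact: (act_pull h^-1%g sa).
rewrite ax //; have XYy : X (act h^-1%g y) -> Y (act h (act h^-1%g y)).
  by near: y; exact: (act_pull h^-1%g XY).
by move=> /XYy; rewrite hy.
Unshelve. all: by end_near. Qed.

End Aut.
End Action.

(** * Exchanging congruent pieces *)

Definition nonoverlapping (R : realType) (n : nat) (A B : set 'rV[R]_n) :=
  \forall x \near generic, ~ (A x /\ B x).

Lemma nonoverlapping_isom (R : realType) (n : nat) (f : isometry R n) A B :
  nonoverlapping A B -> \forall x \near generic, ~ (A (f x) /\ B (f x)).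
Proof. exact: (@generic_isom _ _ f (fun x => ~ (A x /\ B x))). Qed.

Lemma generic_imply (R : realType) (n : nat) (H : Prop) (Q : set 'rV[R]_n) :
  (H -> \forall x \near generic, Q x) -> \forall x \near generic, H -> Q x.
Proof.
have [h|nh] := pselect H => [/(_ h)|_]; first by apply: filterS.
by near=> x.
Unshelve. all: by end_near. Qed.

Section Swaps.
Variables (R : realType) (n : nat) (P : polytope R n).
Local Notation E := 'rV[R]_n.
Local Notation "|P|" := (polytope_set P).
Implicit Types (A X : set E) (g : isometry R n).

Lemma image_isomE g A x : (g @` A) x <-> A (inv_isom g x).
Proof.
split=> [[y Ay <-]|Ax]; first by rewrite isomK.
by exists (inv_isom g x) => //; rewrite isomKV.
Qed.

Lemma image_near (f : isometry R n) (A B : set E) :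
  (\forall x \near generic, A x -> B (f x)) ->
  \forall x \near generic, (f @` A) x -> B x.
Proof.
move=> H; have := generic_isom (inv_isom f) H.
by apply: filterS => x + /image_isomE Ax => /(_ Ax); rewrite isomKV.
Qed.

(** The union of the F i is closed and P is the closure of its interior, so
    covering P generically is covering P. *)
Lemma cover_of_generic (I : finType) (F : I -> set E) :
  (forall i, is_polytope (F i)) -> (forall i, F i `<=` |P|) ->
  (forall i j, i != j -> nonoverlapping (F i) (F j)) ->
  (\forall x \near generic, |P| x -> exists i, F i x) -> cover |P| F.
Proof.
move=> pF FP nF PF; split=> //.
- apply/seteqP; split=> [x [i _ /FP]//|].
  apply: generic_sub.
  + exact/polytope_regclosed/polytopeP.
  + by apply: finite_bigcup_closed => i; exact: polytope_closed.
  + by move: PF; apply: filterS => x + Px => /(_ Px)[i Fx]; exists i.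
- move=> i j _ _ [x xij]; apply/eqP; apply: contrapT => /negP ij.
  by have := generic_disjoint (nF _ _ ij); rewrite -subset0 => /(_ x xij).
Qed.

(** The exchange acts by g on A, by the inverse of g on g A, and trivially on the
    rest of P, which is again a polytope D. *)
Lemma swap_exists A g : is_polytope A ->
  (\forall x \near generic, A x -> |P| x) ->
  (\forall x \near generic, A x -> |P| (g x)) ->
  nonoverlapping A (g @` A) ->
  exists s : Aut P, supp s (A `|` g @` A) /\
    \forall x \near generic, A x -> act s x = g x.
Proof.
move=> pA AP gAP nA.
have pgA : is_polytope (g @` A) by exact: isom_polytope.
have pP := polytopeP P.
have cP := polytope_closed pP.
have {}AP : A `<=` |P| by apply: generic_sub => //; exact: polytope_regclosed.
have {}gAP : g @` A `<=` |P|.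
  apply: generic_sub => //; first exact: polytope_regclosed.
  have := generic_isom (inv_isom g) gAP; apply: filterS => x H /image_isomE.
  by move/H; rewrite isomKV.
have [D pD DE] := polytope_diff pP (cuttable_polytope (polytopeU pA pgA)).
have DP : D `<=` |P|.
  apply: generic_sub => //; first exact: polytope_regclosed.
  by move: DE; apply: filterS => x -> [].
pose F (i : option bool) := match i with
  | None => D | Some true => A | Some false => g @` A end.
pose h (i : option bool) := match i with
  | None => id_isom R n | Some true => g | Some false => inv_isom g end.
have cF : cover |P| F.
  apply: cover_of_generic => [[[]|]|[[]|]||] //.
    have nD B : B = A \/ B = g @` A -> nonoverlapping D B.
      move=> BE; rewrite /nonoverlapping; near=> x => -[].
      have -> : D x <-> |P| x /\ ~ (A `|` g @` A) x by near: x.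
      by move=> [_ nx] Bx; apply: nx; case: BE Bx => ->; [left|right].
    have sym B C : nonoverlapping B C -> nonoverlapping C B.
      by rewrite /nonoverlapping; apply: filterS => x nx [? ?]; apply: nx.
    move=> [[]|] [[]|] //= _;
      first [exact: nA | exact: sym | by apply: nD; left | by apply: nD; right
            | by apply: sym; apply: nD; left | by apply: sym; apply: nD; right].
  near=> x => Px; have Dx : D x <-> |P| x /\ ~ (A `|` g @` A) x by near: x.
  have [[Ax|gAx]|nx] := pselect ((A `|` g @` A) x).
  - by exists (Some true).
  - by exists (Some false).
  - by exists None; apply/Dx.
have chF : cover |P| (fun i => h i @` F i).
  pose e (i : option bool) := omap negb i.
  have -> : (fun i => h i @` F i) = F \o e.
    apply/funext => -[[]|] //=; first exact: image_isomK.
    by apply/seteqP; split=> [_ [x Dx <-]//|x Dx]; exists x.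
  by apply: cover_reindex => //; exists e => -[[]|].
exists (sc_class (mk_data cF chF)); set d := mk_data cF chF.
have dE : \forall x \near generic, forall i, F i x -> act (sc_class d) x = h i x.
  near=> x => i Fx.
  have -> : act (sc_class d) x = data_fun d x by near: x; exact: act_class.
  have H : forall k, sc_piece d k x -> data_fun d x = sc_isom d k x.
    by near: x; exact: data_fun_near.
  by have := H (enum_rank i); rewrite /= enum_rankK; apply.
split; last by move: dE; apply: filterS => x /(_ (Some true)).
rewrite /supp; near=> x => nx; have [Px|nPx] := pselect (|P| x); last exact: act_out.
have H : forall i, F i x -> act (sc_class d) x = h i x by near: x.
apply: (H None); have /= -> // : D x <-> |P| x /\ ~ (A `|` g @` A) x by near: x.
Unshelve. all: by end_near. Qed.

Section Multi.
Variables (I : finType) (X : I -> set E) (g : I -> isometry R n).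
Hypothesis pX : forall i, is_polytope (X i).
Hypothesis XP : forall i, \forall x \near generic, X i x -> |P| x.
Hypothesis gXP : forall i, \forall x \near generic, X i x -> |P| (g i x).
Hypothesis XX : forall i j, i != j -> nonoverlapping (X i) (X j).
Hypothesis YY : forall i j, i != j -> nonoverlapping (g i @` X i) (g j @` X j).
Hypothesis XY : forall i j, nonoverlapping (X i) (g j @` X j).
Variable S : set (Aut P).
Hypothesis sS : is_subgroup S.
Hypothesis XS : forall i a, supp a (X i `|` g i @` X i) -> S a.

(** A product of exchanges, one for each i. They have nonoverlapping supports,
    so each acts on its own pair of pieces. The membership in S records that the
    factors, and not only the product, have supports of the required kind. *)
Lemma multi_swap : exists s : Aut P, [/\ S s,
  \forall x \near generic, forall i, X i x -> act s x = g i x &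
  \forall x \near generic, (forall i, ~ X i x /\ ~ (g i @` X i) x) ->
    act s x = x].
Proof.
suff H (r : seq I) : uniq r -> exists s : Aut P, [/\ S s,
    \forall x \near generic, forall i, i \in r -> X i x -> act s x = g i x &
    \forall x \near generic,
      (forall i, i \in r -> ~ X i x /\ ~ (g i @` X i) x) -> act s x = x].
  have [s [Ss s1 s2]] := H (enum I) (enum_uniq _); exists s; split=> //.
    by move: s1; apply: filterS => x + i => /(_ i); rewrite mem_enum; exact.
  by move: s2; apply: filterS => x + nx; apply=> i _; exact: nx.
elim: r => [_|i r IH /= /andP[ir ur]].
  exists 1%g; split; [by case: sS| |]; near=> x => // _; by near: x; exact: act1.
have [s [Ss s1 s2]] := IH ur.
have [t [t2 t1]] := swap_exists (pX i) (@XP i) (@gXP i) (@XY i i).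
exists (t * s)%g; split.
- by case: sS => _ + _; apply=> //; exact: XS t2.
- near=> x => j; have -> : act (t * s)%g x = act t (act s x).
    by near: x; exact: actM.
  have xi : X i x -> act t x = g i x by near: x.
  have s1x : forall k, k \in r -> X k x -> act s x = g k x by near: x.
  have s2x : (forall k, k \in r -> ~ X k x /\ ~ (g k @` X k) x) -> act s x = x.
    by near: x.
  rewrite inE => /orP[/eqP ->{j} Xix|jr Xjx].
    rewrite s2x ?xi // => k kr; split=> [Xkx|Ykx].
      have ik : i != k by apply: contraNneq ir => ->.
      have : ~ (X i x /\ X k x).
        move: k ik {kr Xkx}; near: x; apply: filter_forall => k.
        by apply: generic_imply; exact: XX.
      by apply.
    have : ~ (X i x /\ (g k @` X k) x).
      by move: k {kr Ykx}; near: x; apply: filter_forall => k; exact: XY.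
    by apply.
  rewrite (s1x j) //.
  have Yj : (g j @` X j) (g j x) by exists x.
  have ij : i != j by apply: contraNneq ir => ->.
  have n1 : ~ (X i (g j x) /\ (g j @` X j) (g j x)).
    move: {jr Xjx Yj ij} j; near: x; apply: filter_forall => j.
    exact: nonoverlapping_isom.
  have n2 : ~ ((g i @` X i) (g j x) /\ (g j @` X j) (g j x)).
    move: j ij {jr Xjx Yj n1}; near: x; apply: filter_forall => j.
    by apply: generic_imply => ij; exact: nonoverlapping_isom (YY ij).
  have t2x : ~ (X i `|` g i @` X i) (g j x) -> act t (g j x) = g j x.
    move: {jr Xjx Yj n1 n2 ij} j; near: x; apply: filter_forall => j.
    exact: (@generic_isom _ _ (g j)
      (fun x => ~ (X i `|` g i @` X i) x -> act t x = x)).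
  by apply: t2x => -[?|?]; [apply: n1|apply: n2].
- near=> x => nx; have -> : act (t * s)%g x = act t (act s x).
    by near: x; exact: actM.
  have s2x : (forall k, k \in r -> ~ X k x /\ ~ (g k @` X k) x) -> act s x = x.
    by near: x.
  have t2x : ~ (X i `|` g i @` X i) x -> act t x = x by near: x.
  rewrite s2x ?t2x // => [|k kr]; last by apply: nx; rewrite inE kr orbT.
  by have [|n1 n2 []//] := nx i; rewrite inE eqxx.
Unshelve. all: by end_near. Qed.

End Multi.
End Swaps.

(** * Sup-norm boxes and points deep inside a polytope *)

Section Within.
Variables (R : realType) (n : nat).
Local Notation E := 'rV[R]_n.
Implicit Types (x y z : E) (A B : set E).

(** Closed balls of the sup norm. Isometries are Euclidean, but grids are made of
    boxes, and the two norms differ by a factor n at most. *)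
Definition within (r : R) x y := forall i, `|x 0 i - y 0 i| <= r.

Lemma within_sym r x y : within r x y -> within r y x.
Proof. by move=> H i; rewrite distrC. Qed.

Lemma within_trans y r s x z : within r x y -> within s y z -> within (r + s) x z.
Proof. by move=> xy yz i; apply: le_trans (lerD (xy i) (yz i)); exact: ler_distD. Qed.

Lemma within_le r s x y : r <= s -> within r x y -> within s x y.
Proof. by move=> rs xy i; exact: le_trans rs. Qed.

Lemma withinxx r x : 0 <= r -> within r x x.
Proof. by move=> r0 i; rewrite subrr normr0. Qed.

Lemma nbhs_within x (U : set E) : nbhs x U ->
  exists2 r, 0 < r & forall y, within r x y -> U y.
Proof.
move=> /nbhs_ballP[e /= e0 eU]; exists (e / 2) => [|y xy]; first by lra.
apply: eU; split=> // i j; rewrite /ball /= !(ord1 i).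
by apply: le_lt_trans (xy j) _; lra.
Qed.

Lemma within_nbhs r s x y (A : set E) : (forall z, within r x z -> A z) ->
  within s x y -> s < r -> A° y.
Proof.
move=> rA xy sr; apply/nbhs_ballP; exists (r - s) => /=; first by rewrite subr_gt0.
move=> z [_ yz]; apply: rA; rewrite -(subrKC s r); apply: within_trans xy _ => i.
by apply: ltW; exact: yz.
Qed.

Lemma edist_within (r : R) x y : 0 <= r -> within r x y -> edist x y <= n%:R * r.
Proof.
move=> r0 xy; have nr0 : 0 <= n%:R * r by rewrite mulr_ge0.
rewrite -(ler_sqr _ nr0) ?nnegrE ?sqrtr_ge0 // sqr_sqrtr; last first.
  by apply: sumr_ge0 => i _; exact: sqr_ge0.
apply: (@le_trans _ _ (\sum_(i < n) r ^+ 2)).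
  by apply: ler_sum => i _; rewrite -real_normK ?num_real // lerXn2r ?nnegrE.
rewrite sumr_const card_ord -[_ *+ _]mulr_natl exprMn ler_wpM2r ?sqr_ge0 //.
by rewrite -natrX ler_nat -{1}(expn1 n); case: (n) => // m; rewrite leq_pexp2l.
Qed.

Lemma within_edist x y : within (edist x y) x y.
Proof.
move=> i; rewrite -sqrtr_sqr; apply: ler_wsqrtr.
rewrite (bigD1 i) //= lerDl; apply: sumr_ge0 => j _; exact: sqr_ge0.
Qed.

Lemma isom_within (f : isometry R n) (r : R) x y :
  0 <= r -> within r x y -> within (n%:R * r) (f x) (f y).
Proof.
move=> r0 /(edist_within r0) xy; apply: within_le xy _; rewrite -(isom_dist f).
exact: within_edist.
Qed.

Lemma aff_interior0 (a : 'cV[R]_n) (c : R) x : aff a c x != 0 ->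
  [set x | aff a c x = 0]° = set0.
Proof.
move=> lx; apply/seteqP; split=> // y y0.
have [e /andP[e0 e1] /=] := segment_nbhs x y0.
rewrite aff2 (interior_subset y0 : aff _ _ y = 0) mulr0 add0r => /eqP.
by rewrite mulf_eq0 (negPf lx) orbF gt_eqF.
Qed.

Lemma min_radius (I : finType) (r : I -> R) : (forall i, 0 < r i) ->
  exists2 s, 0 < s & forall i, s <= r i.
Proof.
move=> r0; exists (\big[Num.min/1]_i r i); last by move=> i; exact: bigmin_le.
by elim/big_ind : _ => // x y x0 y0; rewrite lt_min x0.
Qed.

(** Points of A can be moved to points at a fixed depth r inside A while their mutual
    distances, up to the scale r, are at most halved. The faces of the simplices
    composing A divide the space into open convex cells, one for each sign
    vector s; a point y of A lies in the closure of a cell U s contained in A, and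
    is moved to its midpoint with a fixed deep point of that cell. Points of the
    same cell have their distance exactly halved, and points of different cells
    end at depth r in disjoint sets. *)
Lemma push_inside A : is_polytope A -> exists (p : E -> E) (r : R), [/\ 0 < r,
  forall y z, A y -> within r (p y) z -> A z &
  forall y z e, A y -> A z -> e <= r -> within e (p y) (p z) ->
    within (e + e) y z].
Proof.
move=> [K [T [sT AE]]].
have /choice[v Tv] : forall k, exists v : 'I_n.+1 -> E,
    affinely_independent v /\ T k = conv_hull v.
  by move=> k; case: (sT k) => v; exists v.
have /choice[ac acE] : forall k, exists ac : ('I_n.+1 -> 'cV[R]_n) * ('I_n.+1 -> R),
    T k = [set x | forall i, 0 <= aff (ac.1 i) (ac.2 i) x] /\
    forall i, [set x | aff (ac.1 i) (ac.2 i) x = 0]° = set0.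
  move=> k; have [av ->] := Tv k; have [a [c H]] := barycentric av.
  by exists (a, c); split=> [|i]; [exact: conv_hullE|exact: aff_eq0_interior H.2 i].
pose l (ki : K * 'I_n.+1) := aff ((ac ki.1).1 ki.2) ((ac ki.1).2 ki.2).
pose sg (b : bool) (t : R) := if b then t else - t.
pose U (s : {ffun K * 'I_n.+1 -> bool}) := [set z | forall u, 0 < sg (s u) (l u z)].
have lpos u z : 0 < l u z -> \forall w \near z, 0 < l u w.
  have cl : l u w @[w --> z] --> l u z by exact: aff_continuous.
  by move=> /lt_nbhsr; exact: cl.
have lneg u z : l u z < 0 -> \forall w \near z, l u w < 0.
  have cl : l u w @[w --> z] --> l u z by exact: aff_continuous.
  by move=> /lt_nbhsl; exact: cl.
have sgpos b u z : 0 < sg b (l u z) -> \forall w \near z, 0 < sg b (l u w).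
  rewrite /sg; case: b; first exact: lpos.
  by rewrite oppr_gt0 => /lneg; apply: filterS => w; rewrite oppr_gt0.
have nU s z : U s z -> exists2 r, 0 < r & forall w, within r z w -> U s w.
  move=> Uz; apply: (@nbhs_within z (U s)).
  apply: (@filter_forall E _ (fun u w => 0 < sg (s u) (l u w)) (nbhs z)) => u.
  exact: sgpos.
have lmid u y z : l u (2^-1 *: (y + z)) = 2^-1 * (l u y + l u z).
  rewrite scalerDr; have := aff2 ((ac u.1).1 u.2) ((ac u.1).2 u.2) 2^-1 y z.
  have -> : 2^-1 *: y + 2^-1 *: z = (1 - 2^-1) *: y + 2^-1 *: z.
    by congr (_ *: _ + _); lra.
  by rewrite /l aff2; lra.
have pick y : A y -> exists s z, [/\ U s z, U s `<=` A &
    forall u, 0 <= sg (s u) (l u y)].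
  rewrite AE => -[k _ Tky].
  (* an interior point of a simplex that contains y, off all the face hyperplanes *)
  have [b Tb lb] : exists2 b, T k b & forall u, l u b != 0.
    have [|||b kb lb] := @generic_open R n (T k)°
      (fun b => forall u, l u b != 0).
    - apply: filter_forall => u; apply: generic_nonzero; exact: (acE u.1).2 u.2.
    - exact: open_interior.
    - have [z []] : ((T k)° `&` setT) !=set0.
        apply: regclosed_meet; [exact: simplex_regclosed|exact: openT|].
        by exists y.
      by exists z.
    by exists b => //; exact: interior_subset kb.
  (* the signs at the points of the segment from y to b that are close to y *)
  pose s := [ffun u => if l u y == 0 then 0 < l u b else 0 < l u y].
  exists s.
  have sy u : 0 <= sg (s u) (l u y).
    rewrite ffunE /sg; case: (eqVneq (l u y) 0) => [->|ly].
      by rewrite oppr0 if_same.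
    by case: (ltP 0 (l u y)) => [/ltW//|]; rewrite oppr_ge0.
  pose V := [set w | forall u, l u y != 0 -> 0 < sg (s u) (l u w)].
  have [e /andP[e0 e1] Ve] : exists2 e : R, 0 < e < 1 & V ((1 - e) *: y + e *: b).
    apply: segment_nbhs.
    apply: (@filter_forall E _ (fun u w => l u y != 0 -> 0 < sg (s u) (l u w)) (nbhs y)) => u.
    rewrite ffunE; case: eqP => [_|/eqP ly]; first by apply: nearW.
    have /sgpos : 0 < sg (0 < l u y) (l u y).
      rewrite /sg; case: (ltP 0 (l u y)) => // ly0; rewrite oppr_gt0 lt_neqAle ly.
      exact: ly0.
    by apply: filterS.
  exists ((1 - e) *: y + e *: b); split=> //.
  - move=> u; have [ly|ly] := eqVneq (l u y) 0; last exact: Ve.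
    rewrite /l aff2 -!/(l u _) ly mulr0 add0r ffunE ly eqxx /sg.
    case: (ltP 0 (l u b)) => lub; first by rewrite mulr_gt0.
    by rewrite -mulrN mulr_gt0 // oppr_gt0 lt_neqAle lb.
  - move=> w Uw; exists k => //; move: Tb Tky; rewrite (acE k).1 /= => Tb Tky i.
    have := Uw (k, i); have := Tb i; have := Tky i; rewrite -/(l (k, i) _).
    rewrite -/(l (k, i) b) -/(l (k, i) w) ffunE /sg; case: eqP => [_ _|/eqP ly].
      rewrite le_eqVlt eq_sym (negPf (lb _)) /= => ->; exact: ltW.
    rewrite le_eqVlt eq_sym (negPf ly) /= => -> _; exact: ltW.
have /choice[q qE] : forall y, exists s, A y ->
    [/\ U s !=set0, U s `<=` A & forall u, 0 <= sg (s u) (l u y)].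
  move=> y; have [/pick[s [z [Uz UA sy]]]|nA] := pselect (A y).
    by exists s => _; split=> //; exists z.
  by exists [ffun=> true] => /nA.
have /choice[br brE] : forall s, exists br : E * R, 0 < br.2 /\
    (U s !=set0 -> forall w, within br.2 br.1 w -> U s w).
  move=> s; have [[z /[dup] Uz /nU[r r0 rU]]|nU0] := pselect (U s !=set0).
    by exists (z, r).
  by exists (0, 1); split=> // /nU0.
have [|r r0 rE] := @min_radius _ (fun s => (br s).2).
  by move=> s; exact: (brE s).1.
exists (fun y => 2^-1 *: (y + (br (q y)).1)), (2^-1 * r).
have inU y w : A y -> within (2^-1 * r) (2^-1 *: (y + (br (q y)).1)) w -> U (q y) w.
  move=> Ay yw; have [U0 UA sy] := qE y Ay.
  (* w is the midpoint of y and b, and b is as close to the deep point as w allows *)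
  pose b := 2 *: w - y.
  have -> : w = 2^-1 *: (y + b).
    by rewrite /b addrC subrK scalerA mulVf ?scale1r.
  have Ub : U (q y) b.
    apply: (brE _).2 => // i; apply: le_trans (rE (q y)).
    have := yw i; rewrite /b !mxE => H.
    rewrite (_ : _ - _ = 2 * (2^-1 * (y 0 i + (br (q y)).1 0 i) - w 0 i)); last first.
      by field.
    rewrite normrM gtr0_norm //; lra.
  move=> u; rewrite lmid; have := Ub u; have := sy u; rewrite /sg.
  by case: (q y u) => ? ?; lra.
split; first by rewrite mulr_gt0.
- by move=> y z Ay /(inU _ _ Ay); have [_ + _] := qE y Ay; apply.
- move=> y z e Ay Az er yz.
  have qq : q y = q z.
    have Uy := inU y _ Ay (within_le er yz).
    have Uz := inU z _ Az (withinxx _ (mulr_ge0 _ (ltW r0))).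
    apply/ffunP => u; have := Uy u; have := Uz _ u; rewrite invr_ge0 ler0n => /(_ isT).
    by rewrite /sg; case: (q y u) (q z u) => [] [] //; lra.
  move=> i; have := yz i; rewrite qq !mxE.
  rewrite (_ : _ - _ = 2^-1 * (y 0 i - z 0 i)); last by field.
  by rewrite normrM gtr0_norm //; lra.
Qed.

End Within.

(** * Grids *)

Section Grid.
Variables (R : realType) (n : nat).
Local Notation E := 'rV[R]_n.
Implicit Types (x y : E) (d : R) (k : nat).

(** The affine function that maps the i-th side of the box of centre y and radius d
    onto the interval from 0 to k + 1. *)
Definition grid_coord y d k (i : 'I_n) x : R :=
  (x 0 i - y 0 i + d) * k.+1%:R / (2 * d).

(** Half-open cells, so that they are disjoint and cover the open box. *)
Definition grid_cell y d k (q : {ffun 'I_n -> 'I_k.+1}) : set E :=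
  [set x | forall i, (q i)%:R <= grid_coord y d k i x < (q i).+1%:R].

Definition grid_center y d k (q : {ffun 'I_n -> 'I_k.+1}) : E :=
  \row_i (y 0 i - d + (2 * (q i)%:R + 1) * (d / k.+1%:R)).

Definition open_box y d : set E := [set x | forall i, `|x 0 i - y 0 i| < d].

Lemma aff_coord (i : 'I_n) (a c : R) x :
  aff (a *: delta_mx i 0) c x = a * x 0 i + c.
Proof.
rewrite /aff mxE (bigD1 i) //= big1 => [|j /negPf ji]; last first.
  by rewrite !mxE ji mulr0 mulr0.
by rewrite !mxE !eqxx mulr1 addr0 mulrC.
Qed.

Lemma coord_halfspace (i : 'I_n) (a c : R) :
  [set x : E | 0 <= a * x 0 i + c] = [set x | 0 <= aff (a *: delta_mx i 0) c x].
Proof. by apply/seteqP; split=> x /=; rewrite aff_coord. Qed.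

Lemma cuttable_coord (i : 'I_n) (a c : R) : a != 0 ->
  cuttable [set x : E | 0 <= a * x 0 i + c].
Proof.
move=> a0; rewrite coord_halfspace; apply: cuttable_halfspace.
apply: (@aff_interior0 _ _ _ _ (const_mx ((1 - c) / a))).
by rewrite aff_coord mxE mulrC divfK // subrK oner_eq0.
Qed.

Lemma withinE y (r : R) : within r y = [set x : E | forall i,
  ([set x : E | 0 <= 1 * x 0 i + (r - y 0 i)] `&`
   [set x : E | 0 <= -1 * x 0 i + (r + y 0 i)]) x].
Proof.
apply/seteqP; split=> x H i; have := H i; rewrite /setI /= ler_norml.
  by move=> /andP[? ?]; split; lra.
by move=> [? ?]; apply/andP; split; lra.
Qed.

Lemma cuttable_within y (r : R) : cuttable (within r y).
Proof.
rewrite withinE; apply: cuttable_fin => i.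
by apply: cuttableI; apply: cuttable_coord; rewrite ?oppr_eq0 oner_eq0.
Qed.

Lemma closed_within y (r : R) : closed (within r y).
Proof.
rewrite withinE (_ : [set _ | _] = \bigcap_i
    ([set x : E | 0 <= 1 * x 0 i + (r - y 0 i)] `&`
     [set x : E | 0 <= -1 * x 0 i + (r + y 0 i)])).
  apply: closed_bigI => i _; rewrite !coord_halfspace.
  by apply: closedI; exact: closed_aff_ge0.
by apply/seteqP; split=> x H i => [_|]; [exact: H|exact: (H i I)].
Qed.

Lemma cuttable_grid_cell y d k q : 0 < d -> cuttable (@grid_cell y d k q).
Proof.
move=> d0; have k0 : 0 < k.+1%:R / (2 * d) by rewrite divr_gt0 // mulr_gt0.
suff cB i : cuttable [set x : E | (q i)%:R <= grid_coord y d k i x < (q i).+1%:R].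
  exact: (cuttable_fin cB).
have -> : [set x : E | (q i)%:R <= grid_coord y d k i x < (q i).+1%:R] =
    [set x : E | 0 <= k.+1%:R / (2 * d) * x 0 i +
       ((d - y 0 i) * (k.+1%:R / (2 * d)) - (q i)%:R)] `&`
    ~` [set x : E | 0 <= k.+1%:R / (2 * d) * x 0 i +
       ((d - y 0 i) * (k.+1%:R / (2 * d)) - (q i).+1%:R)].
  rewrite /grid_coord; move: d0 k0 => _; under eq_fun do rewrite -mulrA.
  move: (k.+1%:R / (2 * d)) => c _.
  apply/seteqP; split=> x /= => [/andP[h1 h2]|[h1 /negP]].
    by split; [lra|apply/negP; rewrite -ltNge; lra].
  by rewrite -ltNge => h2; apply/andP; split; lra.
by apply: cuttableI; [|apply: cuttableC]; apply: cuttable_coord; rewrite gt_eqF.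
Qed.

Lemma grid_cell_exists y d k x : open_box y d x -> exists q, @grid_cell y d k q x.
Proof.
move=> xy; exists [ffun i => inord (Num.truncn (grid_coord y d k i x))] => i.
have := xy i; rewrite ltr_norml => /andP[x1 x2].
have d0 : 0 < d by lra.
have g0 : 0 <= grid_coord y d k i x.
  by rewrite divr_ge0 ?mulr_ge0 ?ler0n //; lra.
have g1 : grid_coord y d k i x < k.+1%:R.
  rewrite ltr_pdivrMr ?mulr_gt0 // mulrC ltr_pM2l ?ltr0n //; lra.
rewrite ffunE inordK; first exact: truncn_itv.
by rewrite -(ltr_nat R); apply: le_lt_trans g1; rewrite truncn_le.
Qed.

Lemma grid_cell_uniq y d k q q' x :
  @grid_cell y d k q x -> @grid_cell y d k q' x -> q = q'.
Proof.
move=> qx q'x; apply/ffunP => i; apply: val_inj => /=.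
by rewrite -(truncn_def (qx i)) -(truncn_def (q'x i)).
Qed.

Lemma grid_cell_width y d k q x x' : 0 < d ->
  @grid_cell y d k q x -> @grid_cell y d k q x' ->
  forall i, `|x 0 i - x' 0 i| < 2 * d / k.+1%:R.
Proof.
move=> d0 qx qx' i; have k0 : 0 < k.+1%:R :> R by rewrite ltr0n.
have /andP[] := qx i; have /andP[] := qx' i; rewrite /grid_coord.
rewrite !ler_pdivlMr ?ltr_pdivrMr ?mulr_gt0 // -[(q i).+1%:R]natr1 => h1 h2 h3 h4.
rewrite ltr_pdivlMr // -[X in _ * X](gtr0_norm k0) -normrM ltr_norml.
by apply/andP; split; lra.
Qed.

Lemma grid_cell_center y d k q x : 0 < d -> @grid_cell y d k q x ->
  within (d / k.+1%:R) (grid_center y d q) x.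
Proof.
move=> d0 qx i; have k0 : 0 < k.+1%:R :> R by rewrite ltr0n.
have /andP[] := qx i; rewrite /grid_coord mxE.
rewrite ler_pdivlMr ?ltr_pdivrMr ?mulr_gt0 // -[(q i).+1%:R]natr1 => h1 h2.
rewrite ler_pdivlMr // -[X in _ * X](gtr0_norm k0) -normrM ler_norml.
rewrite mulrBl mulrDl -!(mulrA _ (d / _)) divfK ?gt_eqF //.
by apply/andP; split; lra.
Qed.

Lemma grid_center_in y d k q : 0 < d ->
  within (d - d / k.+1%:R) y (@grid_center y d k q).
Proof.
move=> d0 i; rewrite mxE.
have e0 : 0 < d / k.+1%:R by rewrite divr_gt0 ?ltr0n.
have dE : d = k.+1%:R * (d / k.+1%:R) by rewrite mulrC divfK // pnatr_eq0.
have q0 : 0 <= (q i)%:R :> R by rewrite ler0n.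
have qk : (q i)%:R + 1 <= k.+1%:R :> R by rewrite natr1 ler_nat.
rewrite ler_norml; set e := d / k.+1%:R in dE e0 *.
by apply/andP; split; rewrite {1}dE; nra.
Qed.

(** Centres of different cells differ by 2 d / (k + 1) in some coordinate. *)
Lemma grid_center_sep y d k q q' (a : R) u u' : 0 < d -> q != q' ->
  within a (@grid_center y d k q) u -> within a (@grid_center y d k q') u' ->
  exists i, 2 * (d / k.+1%:R) - 2 * a <= `|u 0 i - u' 0 i|.
Proof.
move=> d0 qq' qu qu'.
have [i qi] : exists i, q i != q' i.
  apply/existsP; rewrite -negb_forall; apply: contraNN qq' => /forallP H.
  by apply/eqP/ffunP => i; exact/eqP.
exists i; have := qu i; have := qu' i; rewrite !mxE.
have e0 : 0 < d / k.+1%:R by rewrite divr_gt0 ?ltr0n.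
move: (d / k.+1%:R) e0 => e e0; rewrite !ler_norml => /andP[h1 h2] /andP[h3 h4].
move: qi; rewrite -val_eqE neq_ltn => /orP[]; rewrite -(ler_nat R) -natr1 => qi.
  by rewrite -normrN lter_normr; apply/orP; left; nra.
by rewrite lter_normr; apply/orP; left; nra.
Qed.

End Grid.

(** * Room for a small polytope in a large box *)

Lemma injection_into (J T : finType) (G : {set T}) : (#|J| <= #|G|)%N ->
  exists2 f : J -> T, injective f & forall j, f j \in G.
Proof.
move=> JG; exists (fun j => enum_val (widen_ord JG (enum_rank j))) => [i j|j].
  by move/enum_val_inj/(congr1 val) => /= /val_inj/enum_rank_inj.
exact: enum_valP.
Qed.

Section Room.
Variables (R : realType) (n : nat).
Hypothesis n0 : (0 < n)%N.
Local Notation E := 'rV[R]_n.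

Lemma spaced_gridE k : ((2 * n + 1) * k.+1).-1.+1 = ((2 * n + 1) * k.+1)%N.
Proof. by rewrite prednK // muln_gt0 addn_gt0 orbT. Qed.

Lemma spaced_grid_radius (d : R) k :
  3 * (2 * n + 1)%:R * d / ((2 * n + 1) * k.+1).-1.+1%:R = 3 * (d / k.+1%:R).
Proof.
have a0 : (2 * n + 1)%:R != 0 :> R by rewrite pnatr_eq0 addn1.
have c0 : k.+1%:R != 0 :> R by rewrite pnatr_eq0.
rewrite spaced_gridE natrM; move: (2 * n + 1)%:R (k.+1%:R) a0 c0 => a c a0 c0.
by field; rewrite a0 c0.
Qed.

(** The box of centre y and radius d, which contains the X i, is divided into
    (k + 1)^n cells of radius eps. The candidate boxes of radius eps are placed at
    the centres of a grid of the box of radius rho about z, with K + 1 cells of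
    radius 3 eps in each direction. The maps p i and the depth r come from
    pushing the points of X i inside. *)
Section Counting.
Variables (y z : E) (d : R) (k : nat) (I : finType) (X : I -> set E).
Variables (e : I -> isometry R n) (p : I -> E -> E) (r : R).
Let K := ((2 * n + 1) * k.+1).-1.
Let rho := 3 * (2 * n + 1)%:R * d.
Let eps := d / k.+1%:R.
Hypothesis d0 : 0 < d.
Hypothesis Xbox : forall i, X i `<=` open_box y d.
Hypothesis XX : forall i j, i != j -> nonoverlapping (X i) (X j).
Hypothesis r0 : 0 < r.
Hypothesis pX : forall i u w, X i u -> within r (p i u) w -> X i w.
Hypothesis pp : forall i u w s, X i u -> X i w -> s <= r ->
  within s (p i u) (p i w) -> within (s + s) u w.
Hypothesis er : eps / n%:R < r.

Definition occupied (q : {ffun 'I_n -> 'I_K.+1}) : bool :=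
  `[< exists i x, X i x /\ within eps (grid_center z rho q) (e i x) >].

(** Each occupied box gives a point of some X i, which is then pushed inside X i.
    For two boxes the resulting points cannot be within eps / n of each other.
    If they come from the same X i, the original points would be within
    2 eps / n, and their images under the isometry within 2 eps, whereas points
    of different boxes are at least 4 eps apart. If they come from different X i,
    each lies at depth r > eps / n in one of two nonoverlapping sets. Hence the
    points lie in distinct cells of radius eps / (2 n) of the box about y. *)
Lemma occupied_card : (#|[set q | occupied q]%SET| <= (2 * n * k.+1) ^ n)%N.
Proof.
have rho0 : 0 < rho by rewrite !mulr_gt0 // ltr0n addn1.
have e0 : 0 < eps by rewrite divr_gt0 // ltr0n.
have n0' : 0 < n%:R :> R by rewrite ltr0n.
have [->//|/card_gt0P[q0]] := posnP #|[set q | occupied q]%SET|.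
rewrite inE => /asboolP[i0 _].
have /choice[u uE] : forall q, exists ix : I * E, occupied q ->
    X ix.1 ix.2 /\ within eps (grid_center z rho q) (e ix.1 ix.2).
  move=> q; have [/asboolP[i [x H]]|nq] := boolP (occupied q).
    by exists (i, x).
  by exists (i0, 0) => oq; case/negP: nq.
pose P q := p (u q).1 (u q).2.
have sep q q' : occupied q -> occupied q' -> q != q' ->
    ~ within (eps / n%:R) (P q) (P q').
  move=> oq oq' qq'; rewrite /P; have := uE q' oq'; have := uE q oq.
  case: (u q) (u q') => [i x] [i' x'] /= [Xx cx] [Xx' cx'] w.
  have [ii|ii] := eqVneq i i'.
    move: Xx' cx' w; rewrite -ii => Xx' cx' w.
    have en0 : 0 <= eps / n%:R + eps / n%:R by rewrite addr_ge0 // divr_ge0 // ltW.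
    have [j] := grid_center_sep rho0 qq' cx cx'; rewrite spaced_grid_radius -/eps.
    have := isom_within (e i) en0 (pp Xx Xx' (ltW er) w) j.
    by rewrite mulrDr mulrC divfK ?gt_eqF //; lra.
  have := generic_disjoint (XX ii); rewrite -subset0 => /(_ (p i' x')); apply.
  split; first exact: within_nbhs (fun v => pX Xx (w := v)) w er.
  exact: within_nbhs (fun v => pX Xx' (w := v)) (withinxx _ (lexx 0)) r0.
pose M := (2 * n * k.+1).-1.
have ME : M.+1 = (2 * n * k.+1)%N by rewrite prednK // !muln_gt0 n0.
have /choice[h hE] : forall q, exists h, occupied q -> @grid_cell R n y d M h (P q).
  move=> q; have [oq|nq] := boolP (occupied q); last by exists [ffun=> ord0].
  have [Xq _] := uE q oq; have [|h hq] := @grid_cell_exists R n y d M (P q).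
    by apply: (Xbox (i := (u q).1)); apply: pX Xq _; apply: withinxx; exact: ltW.
  by exists h.
rewrite -ME.
have -> : (M.+1 ^ n = #|{ffun 'I_n -> 'I_M.+1}|)%N by rewrite card_ffun !card_ord.
rewrite -(card_in_imset (f := h)) ?max_card // => q q'; rewrite !finset.in_set => oq oq' hh.
apply/eqP; apply: contrapT => /negP qq'; apply: (sep _ _ oq oq' qq') => i.
have := hE q' oq'; rewrite -hh => hq'.
have := grid_cell_width d0 (hE q oq) hq' i => /ltW/le_trans; apply.
have c0 : k.+1%:R != 0 :> R by rewrite pnatr_eq0.
have n1 : n%:R != 0 :> R by rewrite gt_eqF.
rewrite ME /eps !natrM le_eqVlt; apply/orP; left; apply/eqP.
by move: (k.+1%:R) (n%:R) c0 n1 => a c a0 c0; field; rewrite a0 c0.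
Qed.

End Counting.

(** The set covered by the images of the X i has at most the volume of the box
    of radius d about y; a box larger by the factor 3 (2 n + 1) has therefore enough
    free room for disjoint translates of the cells B j of a grid of the small
    box. The factor 3 keeps the candidate boxes apart, and 2 n + 1 comes from the
    count (2 n)^n + 1 <= (2 n + 1)^n of occupied and needed boxes. *)
Lemma room (y z : E) (d : R) (I : finType) (X : I -> set E)
    (e : I -> isometry R n) : 0 < d ->
  (forall i, is_polytope (X i)) -> (forall i, X i `<=` open_box y d) ->
  (forall i j, i != j -> nonoverlapping (X i) (X j)) ->
  exists (J : finType) (B : J -> set E) (t : J -> E),
    [/\ forall j, cuttable (B j),
        forall i j x, B i x -> B j x -> i = j &
        forall x, open_box y d x -> exists j, B j x] /\
    [/\ forall j x, B j x -> within (3 * (2 * n + 1)%:R * d) z (x + t j),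
        forall i j x x', B i x -> B j x' -> x + t i = x' + t j -> i = j &
        forall i j x, B j x -> ~ (e i @` X i) (x + t j)].
Proof.
move=> d0 pX Xbox XX.
have /choice[pr prE] : forall i, exists pr : (E -> E) * R, [/\ 0 < pr.2,
    forall u w, X i u -> within pr.2 (pr.1 u) w -> X i w &
    forall u w s, X i u -> X i w -> s <= pr.2 -> within s (pr.1 u) (pr.1 w) ->
      within (s + s) u w].
  by move=> i; have [p [r H]] := push_inside (pX i); exists (p, r).
have [|r r0 rE] := @min_radius R I (fun i => (pr i).2); first by move=> i; case: (prE i).
have n0' : 0 < n%:R :> R by rewrite ltr0n.
(* fine enough for d / (k + 1) to be less than n r *)
pose k := Num.truncn (d / (n%:R * r)).
have k0 : 0 < k.+1%:R :> R by rewrite ltr0n.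
have er : d / k.+1%:R / n%:R < r.
  have /truncn_itv/andP[_] : 0 <= d / (n%:R * r).
    by rewrite divr_ge0 ?mulr_ge0 // ltW.
  rewrite -/k ltr_pdivrMr ?mulr_gt0 // => dk.
  by rewrite !ltr_pdivrMr //; lra.
have occ := @occupied_card y z d k I X e (fun i => (pr i).1) r d0 Xbox XX r0.
pose G := [set q | @occupied z d k I X e q]%SET.
have {}occ : (#|G| <= (2 * n * k.+1) ^ n)%N.
  apply: (occ _ _ er) => [i u w Xu H|i u w s Xu Xw sr].
    by have [_ + _] := prE i; apply; [exact: Xu|exact: within_le (rE i) H].
  have [_ _ +] := prE i; apply=> //; exact: le_trans (rE i).
pose J := {ffun 'I_n -> 'I_k.+1}.
set rho := 3 * (2 * n + 1)%:R * d.
have rho0 : 0 < rho by rewrite !mulr_gt0 // ltr0n addn1.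
have [|f f_inj fG] := @injection_into J _ (~: G).
  have le2 : ((2 * n * k.+1) ^ n + k.+1 ^ n <= ((2 * n + 1) * k.+1) ^ n)%N.
    by rewrite !(expnMn _ k.+1) addnC -mulSn leq_mul2r ltn_exp2r // addn1 leqnn orbT.
  rewrite -(leq_add2l #|G|) cardsC.
  rewrite !card_ffun !card_ord; move: #|G| occ => c occ.
  by rewrite spaced_gridE; apply: leq_trans le2; rewrite leq_add2r.
exists J, (@grid_cell R n y d k), (fun j => grid_center z rho (f j) - grid_center y d j).
have fc j x : grid_cell y d j x ->
    within (d / k.+1%:R) (grid_center z rho (f j))
      (x + (grid_center z rho (f j) - grid_center y d j)).
  move=> /(grid_cell_center d0) H i; have := H i; rewrite !mxE.
  by congr (`|_| <= _); ring.
split; split.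
- by move=> j; exact: cuttable_grid_cell.
- by move=> i j x; exact: grid_cell_uniq.
- by move=> x; exact: grid_cell_exists.
- move=> j x /fc H; apply: within_le (within_trans (grid_center_in _ _ rho0) H).
  rewrite spaced_grid_radius; have e0 : 0 < d / k.+1%:R by rewrite divr_gt0.
  by move: (d / _) e0 => ? ?; lra.
- move=> i j x x' xi xj xx; apply: f_inj; apply/eqP; apply: contrapT => /negP ij.
  have := fc j x' xj; rewrite -xx => H.
  have [l] := grid_center_sep rho0 ij (fc i x xi) H; rewrite subrr normr0.
  rewrite spaced_grid_radius; have e0 : 0 < d / k.+1%:R by rewrite divr_gt0.
  by move: (d / _) e0 => ? ?; lra.
- move=> i j x xj [u Xu ux]; have := fG j; rewrite !inE => /negP; apply.
  by apply/asboolP; exists i, u; split=> //; rewrite ux; exact: fc.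
Qed.

End Room.

(** * Commutator subgroups *)

Section Translation.
Variables (R : realType) (n : nat).
Local Notation E := 'rV[R]_n.

Lemma translation_bij (v : E) : bijective (fun x => x + v).
Proof. by exists (fun x => x - v) => x; rewrite ?addrK ?subrK. Qed.

Lemma translation_dist (v x y : E) : edist (x + v) (y + v) = edist x y.
Proof.
by congr Num.sqrt; apply: eq_bigr => i _; rewrite !mxE opprD addrACA subrr addr0.
Qed.

Definition translation (v : E) : isometry R n :=
  Isometry (translation_bij v) (translation_dist v).

End Translation.

Section Commutators.
Variable G : groupType.
Local Open Scope group_scope.
Implicit Types (a b h k u v : G) (H : set G).

Definition second_derived : set G := commutator_subgroup (commutator_subgroup setT).

Lemma commutator_subgroup_subgroup H : is_subgroup (commutator_subgroup H).
Proof.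
split=> [A [[]]//|x y Hx Hy A AH|x Hx A AH]; case: (AH) => -[_ AM AV] _.
  by apply: AM; [exact: Hx|exact: Hy].
by apply: AV; exact: Hx.
Qed.

Lemma commutator_subgroupR H u v : H u -> H v -> commutator_subgroup H [~ u, v].
Proof. by move=> Hu Hv A [_]; apply; exists u => //; exists v. Qed.

Lemma commutator_subgroup_min H A : is_subgroup A ->
  (forall u v, H u -> H v -> A [~ u, v]) -> commutator_subgroup H `<=` A.
Proof. by move=> sA HA x; apply; split=> // _ [u Hu [v Hv <-]]; exact: HA. Qed.

Lemma commutator_subgroup_normal H : (forall u h, H u -> H (u ^ h)) ->
  forall u h, commutator_subgroup H u -> commutator_subgroup H (u ^ h).
Proof.
move=> nH u h; move: u; apply: (@commutator_subgroup_min H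
  [set u | commutator_subgroup H (u ^ h)]).
  have [H1 HM HV] := commutator_subgroup_subgroup H.
  split=> [|x y|x] /=; rewrite ?conj1g ?conjMg ?conjVg //; [exact: HM|exact: HV].
by move=> u v Hu Hv /=; rewrite conjRg; apply: commutator_subgroupR; exact: nH.
Qed.

Lemma second_derived_normal u h : second_derived u -> second_derived (u ^ h).
Proof.
by apply: commutator_subgroup_normal => {}u {}h; exact: commutator_subgroup_normal.
Qed.

Lemma quasi_perfectP : (forall a b, second_derived [~ a, b]) -> quasi_perfect G.
Proof.
move=> H; apply/seteqP; split; last first.
  apply: commutator_subgroup_min; first exact: commutator_subgroup_subgroup.
  by move=> u v _ _; exact: H.
apply: commutator_subgroup_min; first exact: commutator_subgroup_subgroup.
have [_ GM GV] := commutator_subgroup_subgroup (@setT G).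
move=> u v Gu Gv; rewrite commgEl; apply: (GM); first exact: GV.
exact: commutator_subgroup_normal.
Qed.

(** The centralizer of an element modulo the normal subgroup of second derived
    elements is a subgroup. The hypothesis that S generates G is stated
    through the subgroups that contain S. *)
Lemma commutator_generators (S : set G) :
  (forall A, is_subgroup A -> S `<=` A -> forall g, A g) ->
  (forall a b, S a -> S b -> second_derived [~ a, b]) -> quasi_perfect G.
Proof.
move=> gS SS; have [D1 DM DV] := commutator_subgroup_subgroup (commutator_subgroup (@setT G)).
have sub b : is_subgroup [set g | second_derived [~ g, b]].
  split=> [|x y xb yb|x xb] /=.
  - by rewrite comm1g.
  - rewrite (_ : [~ x * y, b] = [~ x, b] ^ y * [~ y, b]).
      by apply: DM => //; exact: second_derived_normal.
    by rewrite /commg /conjg !invgM !mulgA !mulgK.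
  - rewrite (_ : [~ x^-1, b] = ([~ x, b] ^ x^-1)^-1).
      by apply: DV; exact: second_derived_normal.
    by rewrite /commg /conjg !invgM !invgK !mulgA !mulgK.
apply: quasi_perfectP => a b.
have sym x y : second_derived [~ x, y] -> second_derived [~ y, x].
  by rewrite -(invgR y); move/DV; rewrite invgK.
have H c : S c -> forall g, second_derived [~ g, c].
  by move=> Sc; apply: (gS _ (sub c)) => x Sx; exact: SS.
have Ha g : second_derived [~ g, a].
  by apply: (gS _ (sub a)) => c Sc; exact: (sym _ _ (H c Sc a)).
exact: (sym _ _ (Ha b)).
Qed.

(** With u = a (a')^-1 and v = b (b')^-1, both commutators, the factors a' and b'
    disappear from [u, v], since they commute with everything else. *)
Lemma commutator_displaced a b h k :
  let a' := a ^ h^-1 in let b' := b ^ k^-1 in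
  commute a' a -> commute a' b -> commute a' b' -> commute b' a ->
  commute b' b -> second_derived [~ a, b].
Proof.
move=> a' b' a'a a'b a'b' b'a b'b.
(* [u, v] = u^-1 (u ^ v), where u ^ v = (a ^ b) (a')^-1 *)
have cM (x y z : G) : commute x y -> commute x z -> commute x (y ^ z).
  move=> xy xz; apply: commuteM; first exact: commuteV.
  exact: commuteM.
have fixJ (x y : G) : commute x y -> x ^ y = x.
  by move=> xy; rewrite /conjg xy mulKg.
have -> : [~ a, b] = [~ [~ a^-1, h^-1], [~ b^-1, k^-1]].
  rewrite (_ : [~ a^-1, h^-1] = a * a'^-1); last by rewrite commgEl invgK conjVg.
  rewrite (_ : [~ b^-1, k^-1] = b * b'^-1); last by rewrite commgEl invgK conjVg.
  rewrite [RHS]commgEl conjgM conjMg conjVg (fixJ a' b) //.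
  rewrite conjMg (fixJ (a ^ b)); last first.
    by apply/commuteV/commute_sym/cM.
  rewrite (fixJ a'^-1); last first.
    by apply/commuteV/commute_sym/commuteV/commute_sym.
  rewrite invgM invgK -mulgA (mulgA a^-1) -commgEl mulgA.
  have : commute a' [~ a, b].
    by rewrite commgEl; apply: commuteM; [exact: commuteV|exact: cM].
  by move=> ->; rewrite mulgK.
by apply: commutator_subgroupR; apply: commutator_subgroupR.
Qed.

End Commutators.

(** * Generation by small automorphisms *)

(** The cell K None is the box W of radius rho about z 0, while the cells K (Some c)
    have radius less than d, as required to find room in W. The nine boxes of
    radius rho lie far apart in P: three cells touch at most three of them, and
    leave six, which is enough to displace the three cells twice. *)
Section Cells.
Variables (R : realType) (n : nat) (P : polytope R n).
Hypothesis n0 : (0 < n)%N.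
Local Notation E := 'rV[R]_n.
Local Notation "|P|" := (polytope_set P).
Variables (d : R) (z : 'I_9 -> E) (C : finType) (K : option C -> set E) (y : C -> E).
Let rho := 3 * (2 * n + 1)%:R * d.
Hypothesis d0 : 0 < d.
Hypothesis ball_sub : forall j x, within rho (z j) x -> |P| x.
Hypothesis balls_apart : forall i j x x', i != j ->
  within rho (z i) x -> within rho (z j) x' -> ~ within (rho + rho) x x'.
Hypothesis pK : forall c, is_polytope (K c).
Hypothesis K_sub : forall c, K c `<=` |P|.
Hypothesis KK : forall c c', c != c' -> nonoverlapping (K c) (K c').
Hypothesis K_cover : \forall x \near generic, |P| x -> exists c, K c x.
Hypothesis K_box : forall c, K (Some c) `<=` open_box (y c) d.
Hypothesis K_room : forall x, K None x -> within rho (z ord0) x.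
Hypothesis room_K : \forall x \near generic, within rho (z ord0) x -> K None x.

Definition small (a : Aut P) := exists c, supp a (K None `|` K c).

Let center (c : option C) : E := if c is Some c' then y c' else z ord0.

Let K_center c x : K c x -> within rho (center c) x.
Proof.
case: c => [c /K_box xc i|]; last exact: K_room.
have := xc i; rewrite distrC => /ltW/le_trans; apply.
have : 1 <= 3 * (2 * n + 1)%:R :> R by rewrite -natrM ler1n muln_gt0 addn1.
by move=> h; exact: ler_peMl (ltW d0) h.
Qed.

(** Every cell fits into a box of radius rho, so it can be exchanged with a
    translate inside a free box. *)
Lemma displace (I : finType) (c : I -> option C) (j : I -> 'I_9) :
  injective c -> injective j ->
  (forall i i' x, within rho (z (j i)) x -> ~ K (c i') x) ->
  exists h : Aut P, \forall x \near generic,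
    forall i, K (c i) x -> within rho (z (j i)) (act h x).
Proof.
move=> c_inj j_inj jc.
pose g i := translation (z (j i) - center (c i)).
have gj i x : K (c i) x -> within rho (z (j i)) (g i x).
  move=> /K_center H l; have := H l; rewrite !mxE.
  by congr (`|_| <= _); ring.
have [||||||||h [_ hE _]] := @multi_swap R n P I (fun i => K (c i)) g _ _ _ _ _ _ setT.
- by move=> i; exact: pK.
- by move=> i; apply: nearW => x; exact: K_sub.
- by move=> i; apply: nearW => x /gj; exact: ball_sub.
- by move=> i i' ii'; apply: KK; rewrite (inj_eq c_inj).
- move=> i i' ii'; apply: nearW => _ [[x /gj xi <-] [x' /gj xi' xx]].
  apply: (balls_apart (i := j i) (j := j i') _ xi xi'); first by rewrite (inj_eq j_inj).
  rewrite xx; apply: withinxx.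
  by rewrite !(addr_ge0, mulr_ge0) ?ler0n // ltW.
- move=> i i'; apply: nearW => w [Kw [x /gj xi xx]].
  by apply: (jc _ _ _ _ Kw); rewrite -xx; exact: xi.
- by [].
- by [].
exists h; move: hE; apply: filterS => x H i Kx; rewrite (H i Kx); exact: gj.
Qed.

(** A cell has diameter at most 2 rho and the boxes are further apart than that,
    so each cell touches at most one box. *)
Lemma free_balls (I : finType) (c : I -> option C) : (#|I| <= 3)%N ->
  exists j : bool * I -> 'I_9, injective j /\
    forall u i x, within rho (z (j u)) x -> ~ K (c i) x.
Proof.
move=> I3.
pose touched j := `[< exists i x, within rho (z j) x /\ K (c i) x >].
have [|j j_inj jE] := @injection_into (bool * I)%type _ [set j | ~~ touched j]%SET.
  rewrite card_prod card_bool.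
  have touchedI : (#|[set j | touched j]%SET| <= #|I|)%N.
    have /choice[f fE] : forall j, exists oi, touched j ->
        exists i x, [/\ oi = Some i, within rho (z j) x & K (c i) x].
      move=> j; have [/asboolP[i [x [jx ix]]]|nj] := boolP (touched j).
        by exists (Some i) => _; exists i, x.
      by exists None.
    have f_inj : {in [set j | touched j]%SET &, injective f}.
      move=> j j'; rewrite !finset.in_set => tj tj' ff.
      have [i [x [fj jx ix]]] := fE _ tj; have [i' [x' [fj' jx' ix']]] := fE _ tj'.
      move: ix'; have -> : i' = i by apply: Some_inj; rewrite -fj -fj'.
      move=> ix'; apply/eqP; apply: contrapT => /negP jj.
      apply: (balls_apart jj jx jx'); apply: (@within_trans _ _ (center (c i))).
        exact/within_sym/K_center.
      exact: K_center.
    rewrite -(card_in_imset f_inj).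
    have -> : #|I| = #|Some @: [set: I]%SET|.
      by rewrite card_imset ?cardsT //; exact: Some_inj.
    apply/subset_leq_card/fintype.subsetP => _ /imsetP[j tj ->].
    rewrite finset.in_set in tj; have [i [_ [-> _ _]]] := fE _ tj.
    by apply/imsetP; exists i; rewrite ?finset.in_setT.
  have -> : [set j | ~~ touched j]%SET = (~: [set j | touched j])%SET.
    by apply/finset.setP => j; rewrite !finset.inE.
  rewrite -(leq_add2l #|[set j | touched j]%SET|) cardsC card_ord.
  apply: leq_trans (leq_add touchedI (leqnn _)) _; rewrite -mulSn.
  exact: (leq_mul (leqnn 3) I3).
exists j; split=> // u i x jx ix; have := jE u; rewrite finset.in_set => /negP; apply.
by apply/asboolP; exists i, x.
Qed.

Lemma small_commutator a b : small a -> small b -> second_derived [~ a, b]%g.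
Proof.
move=> [ca sa] [cb sb].
(* the cells ca and cb may coincide with each other or with W *)
pose s := undup [:: None; ca; cb].
pose c (i : 'I_(size s)) := nth None s i.
have c_inj : injective c.
  move=> i j /eqP; rewrite nth_uniq ?undup_uniq ?ltn_ord // => /eqP; exact: val_inj.
have s_c c0 : c0 \in s -> exists i, c i = c0.
  move=> c0s; have c0i : (index c0 s < size s)%N by rewrite index_mem.
  by exists (Ordinal c0i); rewrite /c /= nth_index.
have [|j [j_inj jc]] := free_balls c; first by rewrite card_ord; exact: size_undup.
pose X := [set x | exists i, K (c i) x].
pose Y v := [set x | exists i, within rho (z (j (v, i))) x].
have sX a' c' : c' \in s -> supp a' (K None `|` K c') -> supp a' X.
  move=> c's; apply: supp_sub; apply: nearW => x [Kx|Kx].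
    by have [|i iE] := s_c None; [rewrite mem_undup inE|exists i; rewrite iE].
  by have [i iE] := s_c _ c's; exists i; rewrite iE.
have {}sa : supp a X by apply: sX sa; rewrite mem_undup !inE eqxx orbT.
have {}sb : supp b X by apply: sX sb; rewrite mem_undup !inE eqxx !orbT.
have disp v : exists h : Aut P, \forall x \near generic, X x -> Y v (act h x).
  have [|i i' x|h hE] := displace (j := fun i => j (v, i)) c_inj.
  - by move=> i i' /j_inj[].
  - exact: jc.
  exists h; move: hE; apply: filterS => x H [i /H ?]; by exists i.
have [[h hE] [k kE]] := (disp true, disp false).
have sh := supp_conj sa hE; have sk := supp_conj sb kE.
have YX v : \forall x \near generic, ~ (Y v x /\ X x).
  by apply: nearW => x [[i /jc H] [i' /H]].
apply: (commutator_displaced (h := h) (k := k)).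
- exact: supp_commute sh sa (YX _).
- exact: supp_commute sh sb (YX _).
- apply: (supp_commute sh sk); apply: nearW => x [[i xi] [i' xi']].
  apply: (balls_apart _ xi xi'); first by rewrite (inj_eq j_inj).
  by apply: withinxx; rewrite !(addr_ge0, mulr_ge0) ?ler0n // ltW.
- exact: supp_commute sk sa (YX _).
- exact: supp_commute sk sb (YX _).
Qed.

(** The pieces of the cell that are needed to correct h on it: on each of them h is an
    isometry e with image in a single cell, and t is a translation that moves it to
    free room in K None. They are obtained by intersecting the cell with the pieces
    of h, with the inverse images of the cells, and with a grid. *)
Lemma cell_pieces (h : Aut P) (c : C) :
  exists (I : finType) (Z : I -> set E) (e t : I -> isometry R n)
    (c' : I -> option C),
  [/\ forall i, is_polytope (Z i),
      forall i, Z i `<=` K (Some c),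
      \forall x \near generic, K (Some c) x -> exists i, Z i x &
      forall i j, i != j -> nonoverlapping (Z i) (Z j)] /\
  [/\ \forall x \near generic, forall i, Z i x -> act h x = e i x,
      forall i, \forall x \near generic, Z i x -> K (c' i) (e i x),
      forall i, \forall x \near generic, Z i x -> K None (t i x),
      forall i j, i != j -> nonoverlapping (t i @` Z i) (t j @` Z j) &
      forall i j, nonoverlapping (e i @` Z i) (t j @` Z j)].
Proof.
pose D := sc_piece (repr h); pose f := sc_isom (repr h).
have cD := sc_cover (repr h).
have pD i : is_polytope (D i) by case: cD.
have /choice[X XE] : forall u : 'I_(sc_size (repr h)) * option C,
    exists X, is_polytope X /\ \forall x \near generic,
      X x <-> K (Some c) x /\ (D u.1 x /\ K u.2 (f u.1 x)).
  move=> [i c'] /=; have cK : cuttable (D i `&` (inv_isom (f i) @` K c')).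
    by apply: cuttableI; apply: cuttable_polytope => //; exact: isom_polytope.
  have [X pX XE] := polytope_meet (pK (Some c)) cK.
  exists X; split=> //; move: XE; apply: filterS => x [H1 H2].
  have H3 : (inv_isom (f i) @` K c') x <-> K c' (f i x).
    split=> [[w Kw <-]|Kw]; first by rewrite isomKV.
    by exists (f i x) => //; rewrite isomK.
  by split=> [/H1[? [? /H3 ?]]//|[? [? /H3 ?]]]; apply: H2.
have pX u : is_polytope (X u) by case: (XE u).
have {}XE u : \forall x \near generic,
    X u x <-> K (Some c) x /\ (D u.1 x /\ K u.2 (f u.1 x)) by case: (XE u).
have XK u : X u `<=` K (Some c).
  apply: generic_sub; [exact: polytope_regclosed|exact: polytope_closed|].
  by move: (XE u); apply: filterS => x -> [].
have XX u v : u != v -> nonoverlapping (X u) (X v).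
  case: u v => [i c1] [j c2] uv; rewrite /nonoverlapping; near=> x => -[].
  have -> : X (i, c1) x <-> K (Some c) x /\ (D i x /\ K c1 (f i x)).
    by near: x; exact: (XE (i, c1)).
  have -> : X (j, c2) x <-> K (Some c) x /\ (D j x /\ K c2 (f j x)).
    by near: x; exact: (XE (j, c2)).
  move=> [_ [Di K1]] [_ [Dj K2]].
  have Do : forall i, D i x -> (D i)° x by near: x; exact: generic_piece.
  have ij := cover_uniq cD (Do _ Di) (Do _ Dj); move: uv K2; rewrite -ij => uv K2.
  have c12 : c1 != c2 by apply: contraNneq uv => ->.
  have nK : c1 != c2 -> ~ (K c1 (f i x) /\ K c2 (f i x)).
    by near: x; apply: generic_imply => c12'; exact: nonoverlapping_isom (KK c12').
  by apply: nK.
have Xbox u : X u `<=` open_box (y c) d by move=> x /XK/K_box.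
have [J [B [t [[cB BB yB] [Bz tt et]]]]] :=
  room n0 (z ord0) (fun u => f u.1) d0 pX Xbox XX.
have /choice[Z ZE] : forall v : _ * J, exists Z, is_polytope Z /\
    \forall x \near generic, Z x <-> X v.1 x /\ B v.2 x.
  by move=> v; have [Z] := polytope_meet (pX v.1) (cB v.2); exists Z.
have pZ v : is_polytope (Z v) by case: (ZE v).
have {}ZE v : \forall x \near generic, Z v x <-> X v.1 x /\ B v.2 x by case: (ZE v).
pose T (v : 'I_(sc_size (repr h)) * option C * J) := translation (t v.2).
have ZZ u v : u != v -> nonoverlapping (Z u) (Z v).
  case: u v => [u i] [v j] uv; rewrite /nonoverlapping; near=> x => -[].
  have -> : Z (u, i) x <-> X u x /\ B i x by near: x; exact: (ZE (u, i)).
  have -> : Z (v, j) x <-> X v x /\ B j x by near: x; exact: (ZE (v, j)).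
  move=> [Xu Bi] [Xv Bj]; have ij := BB _ _ _ Bi Bj.
  have neq : u != v by apply: contraNneq uv => ->; rewrite ij.
  have nX : u != v -> ~ (X u x /\ X v x).
    by near: x; apply: generic_imply => neq'; exact: XX.
  by apply: nX.
exists _, Z, (fun v => f v.1.1), T, (fun v => v.1.2); split; split=> //.
- move=> v; apply: generic_sub; [exact: polytope_regclosed|exact: polytope_closed|].
  by move: (ZE v); apply: filterS => x -> [/XK].
- near=> x => Kx.
  have [i _ Di] : (\bigcup_i D i) x by case: cD => _ -> _; exact: K_sub Kx.
  have [c' Kc'] : exists c', K c' (f i x).
    have fP : |P| (f i x).
      by apply: (cover_sub (i := i) (sc_cover_image (repr h))); exists x.
    by move: i {Di} fP; near: x; apply: filter_forall => i; exact: generic_isom K_cover.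
  have [j Bj] := yB x (K_box Kx).
  exists ((i, c'), j).
  have -> : Z ((i, c'), j) x <-> X (i, c') x /\ B j x.
    clear Bj Kc' Di; move: i c' j; near: x; do 3![apply: filter_forall => ?].
    exact: (ZE (_, _, _)).
  have -> : X (i, c') x <-> K (Some c) x /\ (D i x /\ K c' (f i x)).
    clear Bj Kc' Di; move: i c'; near: x; do 2![apply: filter_forall => ?].
    exact: (XE (_, _)).
  by [].
- near=> x => v Zx.
  have Dx : D v.1.1 x.
    have : Z v x <-> X v.1 x /\ B v.2 x by move: {Zx} v; near: x; exact: filter_forall.
    move=> [/(_ Zx)[Xx _] _].
    have : X v.1 x <-> K (Some c) x /\ (D v.1.1 x /\ K v.1.2 (f v.1.1 x)).
      by move: {Zx Xx} v; near: x; apply: filter_forall => v; exact: XE.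
    by move=> [/(_ Xx)[_ []]].
  by move: v.1.1 Dx; near: x; exact: data_fun_near.
- move=> v; near=> x; have -> : Z v x <-> X v.1 x /\ B v.2 x by near: x.
  have -> : X v.1 x <-> K (Some c) x /\ (D v.1.1 x /\ K v.1.2 (f v.1.1 x)).
    by near: x; exact: XE.
  by move=> [[_ []]].
- move=> v; near=> x; have -> : Z v x <-> X v.1 x /\ B v.2 x by near: x.
  move=> [_ Bx]; have : within rho (z ord0) (T v x) by exact: Bz.
  by near: x; exact: (generic_isom (T v) room_K).
- move=> [u i] [v j] uv; rewrite /nonoverlapping.
  have gT w : \forall x \near generic, (T w @` Z w) x ->
      B w.2 (inv_isom (T w) x) /\ Z w (inv_isom (T w) x).
    have := generic_isom (inv_isom (T w)) (ZE w); apply: filterS => x H /image_isomE Zw.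
    by split=> //; have [_] := H.1 Zw.
  near=> x => -[Zu Zv].
  have : (T (u, i) @` Z (u, i)) x -> B i (inv_isom (T (u, i)) x) /\
    Z (u, i) (inv_isom (T (u, i)) x) by near: x; exact: (gT (u, i)).
  have : (T (v, j) @` Z (v, j)) x -> B j (inv_isom (T (v, j)) x) /\
    Z (v, j) (inv_isom (T (v, j)) x) by near: x; exact: (gT (v, j)).
  move=> /(_ Zv)[Bj Zj] /(_ Zu)[Bi Zi].
  have ij : i = j.
    apply: tt Bi Bj _; have := isomKV (T (u, i)) x; have := isomKV (T (v, j)) x.
    by rewrite /= => -> ->.
  move: Zj; have -> : T (v, j) = T (u, i) by rewrite /T ij.
  move=> Zj.
  have : ~ (Z (u, i) (inv_isom (T (u, i)) x) /\ Z (v, j) (inv_isom (T (u, i)) x)).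
    by near: x; exact: nonoverlapping_isom (ZZ _ _ uv).
  by apply.
- move=> u v; rewrite /nonoverlapping; near=> x => -[/image_isomE Zu /image_isomE Zv].
  have Xu : X u.1 (inv_isom (f u.1.1) x).
    suff [/(_ Zu)[]] : Z u (inv_isom (f u.1.1) x) <->
      X u.1 (inv_isom (f u.1.1) x) /\ B u.2 (inv_isom (f u.1.1) x) by [].
    by near: x; exact: (@generic_isom _ _ (inv_isom (f u.1.1))
      (fun x => Z u x <-> X u.1 x /\ B u.2 x) (ZE u)).
  have Bv : B v.2 (inv_isom (T v) x).
    suff [/(_ Zv)[]] : Z v (inv_isom (T v) x) <->
      X v.1 (inv_isom (T v) x) /\ B v.2 (inv_isom (T v) x) by [].
    by near: x; exact: (@generic_isom _ _ (inv_isom (T v))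
      (fun x => Z v x <-> X v.1 x /\ B v.2 x) (ZE v)).
  apply: (et u.1 v.2 _ Bv); exists (inv_isom (f u.1.1) x) => //.
  by rewrite isomKV -[LHS](isomKV (T v)).
Unshelve. all: by end_near. Qed.

(** The product of the exchanges of h Z with t Z moves t Z into the place of h Z; the
    exchanges of t Z with Z then bring each piece Z of the cell back to
    itself. A cell on which h is already trivial is nonoverlapping with K None and
    with the new cell, hence also with the image of the latter under the injective h, so
    the exchanges do not move it. *)
Lemma fragment_step (S : set (Aut P)) (h : Aut P) (c : C) :
  is_subgroup S -> small `<=` S -> exists k, [/\ S k,
    \forall x \near generic, K (Some c) x -> act (k * h)%g x = x &
    forall c1, c1 != c -> (\forall x \near generic, K (Some c1) x -> act h x = x) ->
      \forall x \near generic, K (Some c1) x -> act (k * h)%g x = x].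
Proof.
move=> sS smallS.
have [I [Z [e [t [c' [[pZ ZK KZ ZZ] [hE eK tK tt et]]]]]]] := cell_pieces h c.
have hEi i : \forall x \near generic, Z i x -> act h x = e i x.
  by move: hE; apply: filterS => x /(_ i).
have hVE i : \forall x \near generic, (e i @` Z i) x -> act h^-1%g x = inv_isom (e i) x.
  apply: image_near; near=> x => Zx; rewrite isomK.
  have <- : act h x = e i x by move: Zx; near: x; exact: hEi.
  by near: x; exact: actK.
(* the images of the pieces do not overlap because h is injective *)
have ee i j : i != j -> nonoverlapping (e i @` Z i) (e j @` Z j).
  move=> ij; rewrite /nonoverlapping; near=> x => -[xi xj].
  have hi : act h^-1%g x = inv_isom (e i) x by move: xi; near: x; exact: hVE.
  have hj : act h^-1%g x = inv_isom (e j) x by move: xj; near: x; exact: hVE.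
  have Zi := (image_isomE _ _ _).1 xi; have Zj := (image_isomE _ _ _).1 xj.
  have : ~ (Z i (inv_isom (e i) x) /\ Z j (inv_isom (e i) x)).
    by near: x; exact: nonoverlapping_isom (ZZ _ _ ij).
  by apply; split=> //; rewrite -hi hj.
have eZ i : \forall x \near generic, (e i @` Z i) x -> K (c' i) x.
  exact: image_near (eK i).
have tZ i : \forall x \near generic, (t i @` Z i) x -> K None x.
  exact: image_near (tK i).
have pE (f : I -> isometry R n) i : is_polytope (f i @` Z i) by exact: isom_polytope.
have P_near A c0 : (\forall x \near generic, A x -> K c0 x) ->
    \forall x \near generic, A x -> |P| x.
  by apply: filterS => x H /H; exact: K_sub.
have gE i : comp_isom (t i) (inv_isom (e i)) @` (e i @` Z i) = t i @` Z i.
  apply/seteqP; split=> [_ [_ [x Zx <-] <-]|_ [x Zx <-]].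
    by exists x => //=; rewrite isomK.
  by exists (e i x); [exists x|rewrite /= isomK].
have small2 i a : supp a ((e i @` Z i) `|` (t i @` Z i)) -> S a.
  move=> sa; apply: smallS; exists (c' i); apply: supp_sub sa; near=> x => -[xe|xt].
    by right; move: xe; near: x; exact: eZ.
  by left; move: xt; near: x; exact: tZ.
have small1 i a : supp a ((t i @` Z i) `|` Z i) -> S a.
  move=> sa; apply: smallS; exists (Some c); apply: supp_sub sa; near=> x => -[xt|xZ].
    by left; move: xt; near: x; exact: tZ.
  by right; exact: ZK xZ.
have tZn i j : nonoverlapping (t i @` Z i) (Z j).
  rewrite /nonoverlapping; near=> x => -[xt /ZK xZ].
  have Kx : K None x by move: xt; near: x; exact: tZ.
  have : ~ (K None x /\ K (Some c) x) by near: x; exact: KK.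
  by apply.
(* s2 exchanges h Z with t Z, and s1 exchanges t Z with Z *)
have [||||||||s2 [S2 s2E s2f]] := @multi_swap R n P I (fun i => e i @` Z i)
    (fun i => comp_isom (t i) (inv_isom (e i))) _ _ _ _ _ _ S.
- exact: pE.
- by move=> i; exact: P_near (eZ i).
- move=> i; have := generic_isom (inv_isom (e i)) (tK i); apply: filterS => x H.
  by move=> /image_isomE/H; exact: K_sub.
- exact: ee.
- by move=> i j ij; rewrite !gE; exact: tt.
- by move=> i j; rewrite gE; exact: et.
- exact: sS.
- by move=> i a; rewrite gE; exact: small2.
have [||||||||s1 [S1 s1E s1f]] := @multi_swap R n P I (fun i => t i @` Z i)
    (fun i => inv_isom (t i)) _ _ _ _ _ _ S.
- exact: pE.
- by move=> i; exact: P_near (tZ i).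
- move=> i; have H : \forall x \near generic, Z i x -> |P| (inv_isom (t i) (t i x)).
    by apply: nearW => x /ZK; rewrite isomK; exact: K_sub.
  exact: (image_near (B := fun x => |P| (inv_isom (t i) x)) H).
- exact: tt.
- by move=> i j ij; rewrite !image_isomK; exact: ZZ.
- by move=> i j; rewrite image_isomK; exact: tZn.
- exact: sS.
- by move=> i a; rewrite image_isomK; exact: small1.
exists (s1 * s2)%g; split.
- by case: sS => _ + _; apply.
- near=> x => Kx; rewrite -mulgA.
  have -> : act (s1 * (s2 * h))%g x = act s1 (act (s2 * h)%g x) by near: x; exact: actM.
  have -> : act (s2 * h)%g x = act s2 (act h x) by near: x; exact: actM.
  have [i Zx] : exists i, Z i x by move: Kx; near: x.
  have hx : act h x = e i x by move: i Zx; near: x.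
  have -> : act s2 (act h x) = t i x.
    have H : forall i, (e i @` Z i) (act h x) ->
        act s2 (act h x) = comp_isom (t i) (inv_isom (e i)) (act h x).
      by near: x; exact: (act_pull h s2E).
    rewrite (H i); last by rewrite hx; exists x.
    by rewrite hx /= isomK.
  have H : forall i, (t i @` Z i) (t i x) -> act s1 (t i x) = inv_isom (t i) (t i x).
    near: x; apply: filter_forall => i.
    have Hi : \forall x \near generic, (t i @` Z i) x -> act s1 x = inv_isom (t i) x.
      by move: s1E; apply: filterS => x /(_ i).
    exact: (@generic_isom _ _ (t i)
      (fun x => (t i @` Z i) x -> act s1 x = inv_isom (t i) x) Hi).
  by rewrite H ?isomK //; exists x.
- move=> c1 c1c hc1; near=> x => Kx; rewrite -mulgA.
  have -> : act (s1 * (s2 * h))%g x = act s1 (act (s2 * h)%g x) by near: x; exact: actM.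
  have -> : act (s2 * h)%g x = act s2 (act h x) by near: x; exact: actM.
  have hx : act h x = x by move: Kx; near: x.
  have nKc : ~ (K (Some c1) x /\ K (Some c) x) by near: x; exact: KK.
  have nKN : ~ (K (Some c1) x /\ K None x) by near: x; exact: KK.
  have nZ i : ~ Z i x by move=> /ZK Kc; exact: nKc.
  have nt i : ~ (t i @` Z i) x.
    move=> tx; apply: nKN; split=> //; move: i tx {nZ}; near: x.
    by apply: filter_forall => i; exact: tZ.
  have ne i : ~ (e i @` Z i) x.
    move=> ex; apply: (nZ i); have <- : inv_isom (e i) x = x.
      have <- : act h^-1%g x = inv_isom (e i) x.
        by move: {nZ nt} i ex; near: x; apply: filter_forall => i; exact: hVE.
      by rewrite -[in LHS]hx; near: x; exact: actK.
    exact/image_isomE.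
  rewrite hx.
  have -> : act s2 x = x.
    have H : (forall i, ~ (e i @` Z i) x /\
        ~ (comp_isom (t i) (inv_isom (e i)) @` (e i @` Z i)) x) -> act s2 x = x.
      by near: x.
    by apply: H => i; rewrite gE.
  have H : (forall i, ~ (t i @` Z i) x /\ ~ (inv_isom (t i) @` (t i @` Z i)) x) ->
      act s1 x = x by near: x.
  by apply: H => i; rewrite image_isomK.
Unshelve. all: by end_near. Qed.

Lemma small_generates (S : set (Aut P)) : is_subgroup S -> small `<=` S ->
  forall g, S g.
Proof.
move=> sS smallS g; have [S1 SM SV] := sS.
have H (s : seq C) : uniq s -> exists2 k, S k & forall c, c \in s ->
    \forall x \near generic, K (Some c) x -> act (k * g)%g x = x.
  elim: s => [_|c s IH /= /andP[cs us]]; first by exists 1%g.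
  have [k Sk kE] := IH us; have [k' [Sk' k1 k2]] := fragment_step (k * g)%g c sS smallS.
  exists (k' * k)%g; first exact: SM.
  move=> c1; rewrite inE -mulgA => /orP[/eqP->//|c1s]; apply: k2; last exact: kE.
  by apply: contraNneq cs => <-.
have [k Sk kE] := H _ (enum_uniq C).
have -> : g = (k^-1 * (k * g))%g by rewrite mulKg.
apply: SM; first exact: SV.
apply: smallS; exists None; rewrite /supp; near=> x => nK.
have [Px|nP] := pselect (|P| x); last exact: act_out.
have [[c|] Kx] : exists c, K c x by move: Px; near: x.
  move: c Kx; near: x; apply: filter_forall => c; apply: kE; exact: mem_enum.
by case: nK; left.
Unshelve. all: by end_near. Qed.

Lemma cells_quasi_perfect : quasi_perfect (Aut P).
Proof.
by apply: commutator_generators small_commutator; exact: small_generates.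
Qed.

End Cells.

(** * Dividing a polytope into cells *)

Section Setup.
Variables (R : realType) (n : nat).
Local Notation E := 'rV[R]_n.

Lemma polytope_bounded (A : set E) : is_polytope A ->
  exists2 D : R, 0 < D & A `<=` open_box 0 D.
Proof.
move=> /polytope_union_of; elim=> [|S B [v _ ->] _ [D D0 BD]]; first by exists 1.
pose V := \sum_j \sum_i `|v j 0 i|.
have V0 : 0 <= V by apply: sumr_ge0 => j _; apply: sumr_ge0.
exists (V + D); first by rewrite ltr_wpDl.
move=> x [[t [t0 t1] <-]|/BD Bx] i; last first.
  by apply: lt_le_trans (Bx i) _; rewrite lerDr.
apply: (@le_lt_trans _ _ V); last by rewrite ltrDl.
rewrite mxE subr0 summxE; apply: le_trans (ler_norm_sum _ _ _) _.
apply: ler_sum => j _; rewrite mxE normrM (ger0_norm (t0 j)).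
have tj : t j <= 1 by rewrite -t1 (bigD1 j) //= lerDl; apply: sumr_ge0.
apply: (@le_trans _ _ `|v j 0 i|); first by rewrite ler_piMl.
by rewrite (bigD1 i) //= lerDl; apply: sumr_ge0.
Qed.

Lemma empty_quasi_perfect (P : polytope R n) :
  polytope_set P = set0 -> quasi_perfect (Aut P).
Proof.
move=> P0; have one (a : Aut P) : a = 1%g.
  by apply: act_inj; apply: nearW => x; rewrite !act_out // P0.
apply: quasi_perfectP => a b; rewrite (one [~ a, b]%g).
by case: (@commutator_subgroup_subgroup (Aut P) (commutator_subgroup setT)).
Qed.

End Setup.

Unset Implicit Arguments.

(** P may be assumed to have an interior point q, the centre of a box of radius
    r = 60 rho in P. The nine boxes are lined up on the diagonal at distances
    6 rho, and the cells are those of a fine grid of a box containing P. *)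
Theorem corollaryB (R : realType) (n : nat) (hn : (1 <= n)%N)
    (P : polytope R n) : quasi_perfect (Aut P).
Proof.
have pP := polytopeP P; have rP := polytope_regclosed pP.
have cP := polytope_closed pP.
have [P0|/set0P[p Pp]] := eqVneq (polytope_set P) set0.
  exact: empty_quasi_perfect.
have [q [qP _]] := regclosed_meet rP openT (ex_intro _ p (conj Pp I)).
have [r r0 rE] := nbhs_within qP.
pose rho := r / 60.
have rho0 : 0 < rho by rewrite divr_gt0.
have c0 : 0 < 3 * (2 * n + 1)%:R :> R by rewrite mulr_gt0 // ltr0n addn1.
pose d := rho / (3 * (2 * n + 1)%:R).
have d0 : 0 < d by rewrite divr_gt0.
have rhoE : 3 * (2 * n + 1)%:R * d = rho by rewrite mulrC divfK // gt_eqF.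
pose z (j : 'I_9) : 'rV[R]_n := q + const_mx (6 * rho * j%:R).
have [D D0 PD] := polytope_bounded pP.
(* grid cells of a box of radius D then have radius less than d *)
pose M := Num.truncn (D / d).
have Md : D / M.+1%:R < d.
  have /truncn_itv/andP[_] : 0 <= D / d by rewrite divr_ge0 // ltW.
  by rewrite -/M ltr_pdivrMr // ltr_pdivrMr ?ltr0n // mulrC.
pose C := {ffun 'I_n -> 'I_M.+1}.
pose L (c : option C) := if c is Some c' then
  @grid_cell R n 0 D M c' `&` ~` within rho (z ord0) else within rho (z ord0).
have Luniq c c' x : L c x -> L c' x -> c = c'.
  case: c c' => [c|] [c'|] //= => [[cx _] [c'x _]|[_ + ?]|+ []] //.
  by rewrite (grid_cell_uniq cx c'x).
have /choice[K KE] : forall c, exists K, is_polytope K /\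
    \forall x \near generic, K x <-> polytope_set P x /\ L c x.
  move=> c; have [|K] := @polytope_meet R n P (L c) pP; last by exists K.
  case: c => [c|]; last exact: cuttable_within.
  apply: cuttableI; first exact: cuttable_grid_cell.
  exact/cuttableC/cuttable_within.
have pK c : is_polytope (K c) by case: (KE c).
have {}KE c : \forall x \near generic, K c x <-> polytope_set P x /\ L c x.
  by case: (KE c).
have Ksub c (B : set 'rV[R]_n) : closed B ->
    (forall x, polytope_set P x -> L c x -> B x) -> K c `<=` B.
  move=> cB LB; apply: generic_sub => //; first exact: polytope_regclosed.
  by move: (KE c); apply: filterS => x -> []; exact: LB.
have zP j x : within rho (z j) x -> polytope_set P x.
  move=> zx; apply: rE => i; have := zx i; rewrite !mxE.
  have j8 : j%:R <= 8 :> R by rewrite (ler_nat R _ 8) -ltnS.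
  have j0 : 0 <= j%:R :> R by [].
  rewrite !ler_norml => /andP[h1 h2]; have : r = 60 * rho by rewrite /rho; field.
  by move=> ->; apply/andP; split; nra.
apply: (@cells_quasi_perfect R n P hn d z C K (fun c => grid_center 0 D c)) => //.
- by move=> j x; rewrite rhoE; exact: zP.
- rewrite rhoE => i j x x' ij ix jx' xx.
  pose o := Ordinal hn; have := ix o; have := jx' o; have := xx o; rewrite !mxE.
  rewrite !ler_norml => /andP[h1 h2] /andP[h3 h4] /andP[h5 h6].
  move: ij; rewrite -val_eqE neq_ltn /= => /orP[]; rewrite -(ler_nat R) -natr1 => ij; nra.
- by move=> c; apply: Ksub.
- move=> c c' cc; rewrite /nonoverlapping; near=> x => -[].
  have -> : K c x <-> polytope_set P x /\ L c x by near: x.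
  have -> : K c' x <-> polytope_set P x /\ L c' x by near: x.
  by move=> [_ Lc] [_ Lc']; move: cc; rewrite (Luniq _ _ _ Lc Lc') eqxx.
- near=> x => Px; have [w|nw] := pselect (within rho (z ord0) x).
    by exists None; have -> : K None x <-> polytope_set P x /\ L None x by near: x.
  have [c xc] := @grid_cell_exists R n 0 D M x (PD _ Px).
  exists (Some c).
  have -> // : K (Some c) x <-> polytope_set P x /\ L (Some c) x.
  by move: {xc} c; near: x; apply: filter_forall => c.
- move=> c x Kx i; have Kc : K (Some c) `<=` within (D / M.+1%:R) (grid_center 0 D c).
    apply: Ksub; first exact: closed_within.
    by move=> u _ [uc _]; exact: grid_cell_center.
  by apply: le_lt_trans Md; have := Kc _ Kx i; rewrite distrC.
- by rewrite rhoE; apply: Ksub => //; exact: closed_within.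
- rewrite rhoE; near=> x => xw.
  have -> : K None x <-> polytope_set P x /\ L None x by near: x.
  by split=> //; exact: zP xw.
Unshelve. all: by end_near. Qed.
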